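(* Let $N\in\mathbb N$, $N\ge1$, and $0<\rho<\frac1N$. The energy $\mathcal E^N_\rho$ admits a minimizer $X\in\mathcal{AD}^N_\rho$; moreover each minimizer is of the form $X=\{x_1,\dots,x_N\}$, where $x_1<\dots<x_N$ and $d(x_i,x_{i+1})=\frac1N$ for every $i=1,\dots,N-1$.
   Context: Fix $\lambda>0$. Let $d(x,y):=\min\{|x-y|,1-|x-y|\}$ for $x,y\in[0,1)$ (the distance on the circle of length $1$). Admissible dislocations: $\mathcal{AD}^N_\rho$ is the family of all sets $\{x_1,\dots,x_N\}\subset[0,1)$ of $N$ points such that $d(x_i,x_j)\ge\rho$ for all $i\ne j$. For $X=\{x_1,\dots,x_N\}\in\mathcal{AD}^N_\rho$ set $Y(X):=\{x_j+k : 1\le j\le N,\ k\in\mathbb Z\}\subset\mathbb R$, and let $h_X\in BV_{loc}(\mathbb R)$ be defined, up to an additive constant, by $$h_X'=-\frac{\lambda}{N}\sum_{y\in Y(X)}\delta_y$$ in the sense of distributions, where $\delta_y$ is the Dirac mass at $y$. Let $I_\rho:=(-\frac12,-\rho)\cup(\rho,\frac12)$ and $$E_\rho(h):=\int_0^1\int_{I_\rho}\frac{|h(y+z)-h(y)|^2}{|z|^2}\,dz\,dy,\qquad \mathcal E^N_\rho(X):=E_\rho(h_X)\quad\text{for } X\in\mathcal{AD}^N_\rho.$$ *)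

(* Defs.v *)
From HB Require Import structures.
From mathcomp Require Import all_boot all_order all_algebra.
From mathcomp Require Import all_classical all_reals all_analysis.

Set Implicit Arguments.
Unset Strict Implicit.
Unset Printing Implicit Defensive.

Import Order.TTheory GRing.Theory Num.Theory numFieldNormedType.Exports.

Local Open Scope classical_set_scope.
Local Open Scope ring_scope.

Definition circle_dist (R : realType) (x y : R) : R :=
  Num.min `|x - y| (1 - `|x - y|).

Definition admissible (R : realType) (N : nat) (rho : R) (X : set R) : Prop :=
  [/\ X `<=` `[0, 1[, (X #= `I_N)%card &
      forall x y, X x -> X y -> x <> y -> rho <= circle_dist x y].

Definition periodization (R : realType) (X : set R) : set R :=
  [set y | exists2 x, X x & exists k : int, y = x + k%:~R].

Definition fun_supp (R : realType) (phi : R -> R) : set R :=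
  closure [set x | phi x != 0].

Definition test_function (R : realType) (phi : R -> R) : Prop :=
  (forall (n : nat) (x : R), derivable (derive1n n phi) x 1) /\
  compact (fun_supp phi).

Definition locally_BV (R : realType) (h : R -> R) : Prop :=
  locally_integrable setT h /\
  forall A : set R, open A -> bounded_set A ->
    has_ubound [set v | exists phi : R -> R,
      [/\ test_function phi, fun_supp phi `<=` A, forall x, `|phi x| <= 1 &
          v = \int[@lebesgue_measure R]_(x in A) (h x * derive1 phi x)]].

(* h' = c * (sum of the Dirac masses at the points of Y) in the sense of
   distributions.  The sum is over the points of Y where phi does not vanish,
   which are finitely many when Y is locally finite; the library's finitely
   supported sum would be 0 otherwise. *)
Definition distr_deriv_dirac (R : realType) (h : R -> R) (c : R) (Y : set R)
    : Prop :=
  forall phi : R -> R, test_function phi ->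
    - (\int[@lebesgue_measure R]_x (h x * derive1 phi x))
    = c * \sum_(y \in Y) phi y.

Definition is_displacement (R : realType) (lambda : R) (N : nat) (X : set R)
    (h : R -> R) : Prop :=
  locally_BV h /\
  distr_deriv_dirac h (- (lambda / N%:R)) (periodization X).

(* h_X is only determined almost everywhere and up to an additive constant, which
   does not affect the energy below: we choose a representative. *)
Definition displacement (R : realType) (lambda : R) (N : nat) (X : set R)
    : R -> R :=
  xget (fun=> 0) [set h | is_displacement lambda N X h].

Definition core_domain (R : realType) (rho : R) : set R :=
  `]- 2^-1, - rho[ `|` `]rho, 2^-1[.

Definition core_energy (R : realType) (rho : R) (h : R -> R) : \bar R :=
  (\int[@lebesgue_measure R]_(y in `[0%R, 1%R])
     \int[@lebesgue_measure R]_(z in core_domain rho)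
       (`|h (y + z)%R - h y| ^+ 2 / `|z| ^+ 2)%:E)%E.

Definition dislocation_energy (R : realType) (lambda : R) (N : nat) (rho : R)
    (X : set R) : \bar R :=
  core_energy rho (displacement lambda N X).

Definition is_minimizer (R : realType) (lambda : R) (N : nat) (rho : R)
    (X : set R) : Prop :=
  admissible N rho X /\
  forall X' : set R, admissible N rho X' ->
    (dislocation_energy lambda N rho X <= dislocation_energy lambda N rho X')%E.

(* Main.v *)
Require Import Defs.
From mathcomp Require Import all_boot all_order all_algebra.
From mathcomp Require Import all_classical all_reals all_analysis.
From mathcomp Require Import measurable_realfun.
From mathcomp Require Import zify ring lra.

Import Order.TTheory GRing.Theory Num.Theory numFieldNormedType.Exports.

Local Open Scope classical_set_scope.
Local Open Scope ring_scope.

Set Implicit Arguments.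
Unset Strict Implicit.
Unset Printing Implicit Defensive.

(** Up to an additive constant and a null set, h_X is the staircase
    h (x) = - (lambda / N) * \sum_(a in X) floor (x - a).  Hence
    |h (y + z) - h (y)| = (lambda / N) |n (z, y)|, where the integer
    n (z, y) = \sum_(a in X) (floor (y + z - a) - floor (y - a)) counts, with
    sign, the points of X + Z between y and y + z.  Since
    \int_0^1 floor (y + t) dy = t for every real t, the mean over y in [0, 1] of
    n (z, y) is N z, whatever X is.

    An integer n satisfies (n - m) (n - m - 1) >= 0 for every integer m; with
    m = floor (N z), integrating over y gives
      \int_0^1 n (z, y)^2 dy >= (2 m + 1) N z - m (m + 1),
    with equality exactly when n (z, y) is m or m + 1 for almost every y
    (mean_square_jump_ge).  The equispaced points i / N have this property for all z
    at once, because translating by 1 / N raises their sum of floors by exactly 1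
    (mean_square_jump_equispaced).  After exchanging the two integrals (Tonelli), the
    equispaced configuration therefore minimizes the energy for each z separately.

    Conversely, suppose that two points of X are at circle distance d < 1 / N.  For
    z slightly below 1 / N one has m = 0, but n (z, y) >= 2 for all y in an interval
    of positive length, so the inequality is strict for these z, and they lie in the
    domain of integration because 1 / N <= 1 / 2 (core_energy_equispaced_lt).  So all
    pairs of points of a minimizer are at distance at least 1 / N; as the N gaps
    around the circle add up to 1, they all equal 1 / N.

    What remains is to identify h_X, which is defined by a distributional
    equation.  That the staircase solves it is integration by parts for a step function.
    Uniqueness is the du Bois-Reymond lemma (du_bois_reymond): a locally integrable g
    with \int g phi' = 0 for all test functions is constant almost everywhere.  For
    this, phi is a difference of two smooth steps based at Lebesgue points a and b
    of g, each rising from 0 to 1 over a length e; then \int g phi' tends to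
    g (a) - g (b) when e tends to 0.  Such a step is e(x) / (e(x) + e(1 - x)) with
    e(x) = exp (-1 / x) for x > 0 and 0 elsewhere. *)

(** * Smooth step functions *)

(** Giving the derivative as a witness, instead of through [derive1], makes the
    closure properties plain inductions on [n]. *)
Fixpoint ndiff (R : realType) (n : nat) (f : R -> R) : Prop :=
  if n is m.+1 then
    exists f' : R -> R, (forall x : R, is_derive x 1 f (f' x)) /\ ndiff m f'
  else True.

Definition smooth (R : realType) (f : R -> R) : Prop := forall n, ndiff n f.

Section Smooth.
Context {R : realType}.
Implicit Types f g : R -> R.

Lemma ndiffW n f : ndiff n.+1 f -> ndiff n f.
Proof.
elim: n f => [//|n IH] f [f' [ff' nf']].
by exists f'; split => //; exact: IH.
Qed.

Lemma smooth_derivable f : smooth f ->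
  forall n x, derivable (derive1n n f) x 1.
Proof.
move=> sf n; move: (sf n.+1); elim: n f {sf} => [|n IH] f [f' [ff' nf']] x.
  by case: (ff' x).
rewrite derive1Sn; suff -> : derive1 f = f' by exact: IH.
by apply/funext => y; rewrite derive1E; case: (ff' y).
Qed.

Lemma ndiff_cst n (c : R) : ndiff n (fun=> c).
Proof.
elim: n c => [//|n IH] c; exists (fun=> 0); split; last exact: IH.
by move=> x; exact: is_derive_cst.
Qed.

Lemma ndiffD n f g : ndiff n f -> ndiff n g -> ndiff n (fun x => f x + g x).
Proof.
elim: n f g => [//|n IH] f g [f' [ff' nf]] [g' [gg' ng]].
exists (fun x => f' x + g' x); split; last exact: IH.
by move=> x; have := ff' x; have := gg' x => ? ?; exact: is_deriveD.
Qed.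

Lemma ndiffM n f g : ndiff n f -> ndiff n g -> ndiff n (fun x => f x * g x).
Proof.
elim: n f g => [//|n IH] f g df dg.
have [nf ng] := (ndiffW df, ndiffW dg).
case: df dg => [f' [ff' nf']] [g' [gg' ng']].
exists (fun x => f x * g' x + g x * f' x); split.
  move=> x; have := ff' x; have := gg' x => ? ?.
  exact: is_deriveM.
by apply: ndiffD; apply: IH.
Qed.

Lemma ndiffV n f : (forall x, f x != 0) -> ndiff n f ->
  ndiff n (fun x => (f x)^-1).
Proof.
move=> f0; elim: n => [//|n IH] df.
have nV := IH (ndiffW df); case: df => [f' [ff' nf']].
exists (fun x => - ((f x)^-1 * (f x)^-1) * f' x); split.
  move=> x.
  have := is_deriveV (f0 x) (ff' x) => /is_derive_eq; apply.
  by rewrite -exprVn expr2.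
apply: ndiffM => //.
have -> : (fun x => - ((f x)^-1 * (f x)^-1)) =
    (fun x => (-1) * ((f x)^-1 * (f x)^-1)).
  by apply/funext => x; rewrite mulN1r.
by apply: ndiffM; [exact: ndiff_cst | exact: ndiffM].
Qed.

Lemma ndiff_affine n f (a b : R) : ndiff n f -> ndiff n (fun x => f (a * x + b)).
Proof.
elim: n f => [//|n IH] f [f' [ff' nf']].
exists (fun x => f' (a * x + b) * a); split.
  move=> x; have ? := ff' (a * x + b).
  have ? : is_derive x (1 : R) (fun x : R => a * x + b) a.
    have /is_derive_eq := is_deriveD (is_deriveZ a (is_derive_id x (1 : R)))
      (is_derive_cst b x (1 : R)); apply.
    by rewrite /GRing.scale/= mulr1 addr0.
  exact: (@is_derive1_comp _ f (fun x => a * x + b)).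
by apply: ndiffM; [exact: IH | exact: ndiff_cst].
Qed.

(** The powers [x^-k] are carried along because the derivative of
    [x^-k exp(-1/x)] is a combination of two functions of the same family: that is
    what makes them all smooth by one induction. *)
Definition flat_exp (k : nat) (x : R) : R :=
  if 0 < x then x^-1 ^+ k * expR (- x^-1) else 0.

Lemma flat_exp_ge0 k x : 0 <= flat_exp k x.
Proof.
rewrite /flat_exp; case: ifPn => // x0.
by rewrite mulr_ge0 ?expR_ge0// exprn_ge0// invr_ge0 ltW.
Qed.

Lemma flat_exp_gt0 k x : 0 < x -> 0 < flat_exp k x.
Proof.
by move=> x0; rewrite /flat_exp x0 mulr_gt0 ?expR_gt0// exprn_gt0// invr_gt0.
Qed.

(** From [t^(k+2) / (k+2)! <= exp t] at [t = 1/x].  A quadratic bound is what gives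
    a zero derivative at the origin. *)
Lemma flat_exp_le k x : flat_exp k x <= k.+2`!%:R * x ^+ 2.
Proof.
rewrite /flat_exp; case: ifPn => x0; last by rewrite mulr_ge0 ?sqr_ge0.
have V0 : 0 < x^-1 by rewrite invr_gt0.
have := @expR_ge1Dxn R (x^-1) k.+1 (ltW V0) => h.
rewrite expRN ler_pdivrMr ?expR_gt0//.
have h2 : x^-1 ^+ k.+2 / k.+2`!%:R <= expR x^-1.
  by apply: le_trans h; rewrite lerDr.
rewrite ler_pdivrMr ?ltr0n ?fact_gt0// in h2.
have -> : x^-1 ^+ k = x ^+ 2 * x^-1 ^+ k.+2.
  rewrite -[k.+2]addn2 exprD mulrCA -exprMn mulfV ?gt_eqF//.
  by rewrite expr1n mulr1.
have -> : k.+2`!%:R * x ^+ 2 * expR x^-1 = x ^+ 2 * (expR x^-1 * k.+2`!%:R).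
  by ring.
by rewrite ler_pM2l ?exprn_gt0.
Qed.

Lemma is_derive_flat_exp0 k : is_derive (0 : R) (1 : R) (flat_exp k) 0.
Proof.
have f0 : flat_exp k 0 = 0 by rewrite /flat_exp ltxx.
have cv : h^-1 *: (flat_exp k (h *: 1 + 0) - flat_exp k 0) @[h --> (0:R)^'] --> (0 : R).
  pose C : R := k.+2`!%:R.
  have C0 : 0 < C by rewrite ltr0n fact_gt0.
  apply/cvgrPdist_le => /= e e0; near=> h.
  rewrite f0 subr0 addr0 sub0r normrN /GRing.scale/= mulr1 normrM.
  rewrite (ger0_norm (flat_exp_ge0 _ _)).
  have h0 : h != 0 by near: h; exact: nbhs_dnbhs_neq.
  have hp : 0 < `|h| by rewrite normr_gt0.
  rewrite normfV ler_pdivrMl//.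
  apply: (le_trans (flat_exp_le k h)).
  rewrite -real_normK ?num_real// expr2 mulrA [X in _ <= X]mulrC ler_pM2r//.
  rewrite -ler_pdivlMl//.
  near: h; apply: nbhs_dnbhs.
  apply/nbhs_ballP; exists (C^-1 * e) => /=; first by rewrite mulr_gt0 ?invr_gt0.
  by move=> y; rewrite /ball /= sub0r normrN => /ltW.
apply: DeriveDef.
  by apply/cvg_ex; exists 0.
by apply/cvg_lim.
Unshelve. all: by end_near. Qed.

Lemma is_derive_flat_exp k (x : R) :
  is_derive x (1 : R) (flat_exp k) (- k%:R * flat_exp k.+1 x + flat_exp k.+2 x).
Proof.
have [x0|x0|<-] := ltgtP 0 x.
- pose g (y : R) := y^-1 ^+ k * expR (- y^-1).
  have gf : \forall y \near x, g y = flat_exp k y.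
    near=> y; rewrite /g /flat_exp ifT//.
    by near: y; exact: lt_nbhsr.
  apply: (near_eq_is_derive gf).
  have xn0 : x != 0 by rewrite gt_eqF.
  have dV : is_derive x (1 : R) (fun y : R => y^-1) (- x ^- 2).
    have /is_derive_eq := @is_deriveV _ id x 1 1 xn0 (is_derive_id _ _); apply.
    by rewrite /GRing.scale/= mulr1.
  have dVk : is_derive x (1 : R) (fun y : R => y^-1 ^+ k)
      ((x^-1 ^+ k.-1 *+ k) * (- x ^- 2)).
    case: k {g gf} => [|k].
      by rewrite mulr0n mul0r; apply: (is_derive_cst (1 : R)).
    have /is_derive_eq := is_deriveX k.+1 dV; rewrite exprfctE; apply.
    by rewrite /GRing.scale/= mulr_natl.
  have dN : is_derive x (1 : R) (fun y : R => - y^-1) (x ^- 2).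
    by have /is_derive_eq := is_deriveN dV; apply; rewrite opprK.
  have dE : is_derive x (1 : R) (fun y : R => expR (- y^-1))
       (expR (- x^-1) * x ^- 2).
    exact: (@is_derive1_comp _ expR (fun y : R => - y^-1)).
  have /is_derive_eq := is_deriveM dVk dE; apply.
  rewrite /GRing.scale/= /flat_exp x0 -!exprVn.
  case: k {g gf dVk} => [|k]; last by rewrite -mulr_natl /= !exprS; ring.
  by rewrite mulr0n !exprS; ring.
- have gf : \forall y \near x, cst 0 y = flat_exp k y.
    near=> y; rewrite /flat_exp ifF//; apply/negbTE; rewrite -leNgt.
    by near: y; exact: lt_le_nbhsl.
  apply: (near_eq_is_derive gf).
  apply: is_derive_eq.
  by rewrite /flat_exp ltNge (ltW x0)/= mulr0 addr0.
- apply: is_derive_eq; first exact: is_derive_flat_exp0.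
  by rewrite /flat_exp ltxx mulr0 addr0.
Unshelve. all: by end_near. Qed.

Lemma smooth_flat_exp k : smooth (flat_exp k).
Proof.
move=> n; elim: n k => [//|n IH] k.
exists (fun x => - k%:R * flat_exp k.+1 x + flat_exp k.+2 x); split.
  exact: is_derive_flat_exp.
by apply: ndiffD; [apply: ndiffM; [exact: ndiff_cst|]|].
Qed.

(** The summands of the denominator do not vanish simultaneously, since [x] and
    [1 - x] are not both nonpositive. *)
Definition smooth_step (x : R) : R := flat_exp 0 x / (flat_exp 0 x + flat_exp 0 ((-1) * x + 1)).

Lemma smooth_step_den x : flat_exp 0 x + flat_exp 0 ((-1) * x + 1) != 0.
Proof.
have [x0|x0] := ltP 0 x.
  by rewrite gt_eqF// ltr_wpDr ?flat_exp_ge0 ?flat_exp_gt0.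
by rewrite gt_eqF// ltr_wpDl ?flat_exp_ge0 ?flat_exp_gt0// mulN1r; lra.
Qed.

Lemma smooth_smooth_step : smooth smooth_step.
Proof.
move=> n; apply: ndiffM; first exact: smooth_flat_exp.
apply: ndiffV; first exact: smooth_step_den.
by apply: ndiffD; [|apply: (ndiff_affine (f := flat_exp 0))]; exact: smooth_flat_exp.
Qed.

Lemma smooth_step0 x : x <= 0 -> smooth_step x = 0.
Proof. by move=> x0; rewrite /smooth_step {1}/flat_exp ltNge x0 mul0r. Qed.

Lemma smooth_step1 x : 1 <= x -> smooth_step x = 1.
Proof.
move=> x1; rewrite /smooth_step.
have -> : flat_exp 0 ((-1) * x + 1) = 0 by rewrite /flat_exp ltNge mulN1r ifF//; lra.
by rewrite addr0 divff// gt_eqF// flat_exp_gt0//; lra.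
Qed.

End Smooth.

(** * The du Bois-Reymond lemma *)
Section DuBoisReymond.
Context {R : realType}.
Local Notation mu := (@lebesgue_measure R).
Implicit Types (f g w phi : R -> R).

Lemma smooth_is_derive f : smooth f ->
  forall x, is_derive x (1 : R) f (derive1 f x).
Proof.
move=> sf x; apply: DeriveDef; first by have := @smooth_derivable _ _ sf 0%N x.
by rewrite derive1E.
Qed.

Lemma smooth_derive1_continuous f : smooth f -> continuous (derive1 f : R -> R).
Proof.
move=> sf x; apply: differentiable_continuous; apply/derivable1_diffP.
by have := @smooth_derivable _ _ sf 1%N x.
Qed.

Lemma test_is_derive phi : test_function phi ->
  forall x, is_derive x (1 : R) phi (derive1 phi x).
Proof.
move=> [dphi _] x; apply: DeriveDef; first by have := dphi 0%N x.
by rewrite derive1E.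
Qed.

Lemma test_derive1_continuous phi :
  test_function phi -> continuous (derive1 phi : R -> R).
Proof.
move=> [dphi _] x; apply: differentiable_continuous; apply/derivable1_diffP.
by have := dphi 1%N x.
Qed.

Lemma near_cst_derive1 phi x k : (\forall y \near x, phi y = k) -> derive1 phi x = 0.
Proof.
move=> h; rewrite derive1E (@near_eq_derive _ _ _ _ (cst (k : R)))//.
by rewrite derive_cst.
Qed.

Lemma fun_suppP phi x : ~ fun_supp phi x -> phi x = 0.
Proof.
move=> h; apply/eqP; apply: contrapT => /negP p; apply: h.
exact: subset_closure.
Qed.

Lemma derive1_supp phi x : ~ fun_supp phi x -> derive1 phi x = 0.
Proof.
move=> nx; apply: (@near_cst_derive1 _ _ 0).
have : open (~` fun_supp phi) by apply: closed_openC; exact: closed_closure.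
rewrite openE => /(_ _ nx); apply: filterS => y.
exact: fun_suppP.
Qed.

Lemma test_support phi : test_function phi ->
  exists2 c : R, 0 < c & fun_supp phi `<=` `[- c, c].
Proof.
move=> [_ /compact_bounded /pinfty_ex_gt0[c c0 hc]].
by exists c => // x /hc; rewrite /= in_itv/= ler_norml.
Qed.

Lemma continuous_bounded_itv w a b : a <= b -> continuous w ->
  exists2 M, 0 <= M & forall x, x \in `[a, b] -> `|w x| <= M.
Proof.
move=> ab cw.
have cn : {within `[a, b], continuous (fun x => `|w x|)}.
  by apply: continuous_subspaceT => x; apply: cvg_norm; exact: cw.
have [c cab hc] := EVT_max ab cn.
by exists `|w c|.
Qed.

Lemma locally_integrable_itv g a b : locally_integrable setT g ->
  mu.-integrable `[a, b] (EFin \o g).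
Proof.
move=> [mg _ ig]; apply/integrableP; split.
  by apply/measurable_EFinP; exact: measurable_funTS.
by apply: ig => //; exact: segment_compact.
Qed.

Lemma integrable_mul_itv g w a b : locally_integrable setT g ->
  continuous w -> mu.-integrable `[a, b] (EFin \o (fun x => g x * w x)).
Proof.
move=> lg cw; have [ab|ba] := leP a b; last first.
  by rewrite set_itv_ge -?ltNge ?bnd_simp//; exact: integrable_set0.
have [M M0 hM] := continuous_bounded_itv ab cw.
have := @integrableMl _ _ R mu `[a, b] (measurable_itv _) (EFin \o g) w
  (locally_integrable_itv a b lg).
apply.
  by apply: measurable_funTS; exact: continuous_measurable_fun.
exists M; split; first exact: num_real.
by move=> y My x /= xab; apply: le_trans (ltW My); exact: hM.
Qed.

Lemma mul_supp_patch g w a b :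
  (forall x, x \notin `[a, b] -> w x = 0) ->
  (fun x => g x * w x) = (fun x => g x * w x) \_ `[a, b].
Proof.
move=> w0; apply/funext => x; rewrite patchE; case: ifPn => // xab.
rewrite w0 ?mulr0//; apply: contra xab => ?; exact/mem_set.
Qed.

Lemma integrable_mul_supp g w a b : locally_integrable setT g ->
  continuous w -> (forall x, x \notin `[a, b] -> w x = 0) ->
  mu.-integrable setT (EFin \o (fun x => g x * w x)).
Proof.
move=> lg cw w0; rewrite (mul_supp_patch g w0) -restrict_EFin.
exact: (iffLR (@integrable_mkcond _ _ R mu _ _ (measurable_itv _)) (integrable_mul_itv a b lg cw)).
Qed.

Lemma Rintegral_mul_supp g w a b :
  (forall x, x \notin `[a, b] -> w x = 0) ->
  \int[mu]_x (g x * w x) = \int[mu]_(x in `[a, b]) (g x * w x).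
Proof.
by move=> w0; rewrite [LHS]/= [RHS]Rintegral_mkcond -(mul_supp_patch g w0).
Qed.

(** An approximate identity: the derivative of a smooth step that rises from 0 to 1
    on [[a, a + e]]. *)
Definition bump (e a x : R) := e^-1 * derive1 smooth_step (e^-1 * x + - (e^-1 * a)).

Definition scaled_step (e a x : R) := smooth_step (e^-1 * x + - (e^-1 * a)).

Lemma smooth_scaled_step e a : smooth (scaled_step e a).
Proof. by move=> n; apply: (ndiff_affine (f := smooth_step)); exact: smooth_smooth_step. Qed.

Lemma is_derive_scaled_step e a x :
  is_derive x (1 : R) (scaled_step e a) (bump e a x).
Proof.
have ? := smooth_is_derive (@smooth_smooth_step R) (e^-1 * x + - (e^-1 * a)).
have ? : is_derive x (1 : R) (fun x : R => e^-1 * x + - (e^-1 * a)) e^-1.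
  have /is_derive_eq := is_deriveD (is_deriveZ e^-1 (is_derive_id x (1 : R)))
    (is_derive_cst (- (e^-1 * a)) x (1 : R)); apply.
  by rewrite /GRing.scale/= mulr1 addr0.
rewrite /bump mulrC.
exact: (@is_derive1_comp _ smooth_step (fun x => e^-1 * x + - (e^-1 * a))).
Qed.

Lemma derive1_scaled_step e a : derive1 (scaled_step e a) = bump e a.
Proof.
by apply/funext => x; rewrite derive1E; case: (is_derive_scaled_step e a x).
Qed.

Lemma continuous_bump e a : continuous (bump e a).
Proof.
by rewrite -derive1_scaled_step; apply: smooth_derive1_continuous;
  exact: smooth_scaled_step.
Qed.

Lemma scaled_step0 e a x : 0 < e -> x <= a -> scaled_step e a x = 0.
Proof.
move=> e0 xa; apply: smooth_step0.
by rewrite -mulrBr pmulr_rle0 ?invr_gt0//; lra.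
Qed.

Lemma scaled_step1 e a x : 0 < e -> a + e <= x -> scaled_step e a x = 1.
Proof.
move=> e0 xa; apply: smooth_step1.
by rewrite -mulrBr ler_pdivlMl//; lra.
Qed.

Lemma bump0 e a x : 0 < e -> x \notin `[a, a + e] -> bump e a x = 0.
Proof.
move=> e0; rewrite in_itv/= negb_and -!ltNge => /orP[xa|xa].
  rewrite -derive1_scaled_step; apply: (@near_cst_derive1 _ _ 0); near=> y.
  apply: scaled_step0 => //; near: y; exact: lt_le_nbhsl.
rewrite -derive1_scaled_step; apply: (@near_cst_derive1 _ _ 1); near=> y.
apply: scaled_step1 => //; near: y; exact: lt_le_nbhsr.
Unshelve. all: by end_near. Qed.

Lemma bump_bound : exists2 M : R, 0 < M & forall e a x,
  0 < e -> `|bump e a x| <= e^-1 * M.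
Proof.
have [M M0 hM] := continuous_bounded_itv ler01
   (smooth_derive1_continuous (@smooth_smooth_step R)).
exists (M + 1) => [|e a x e0]; first by rewrite ltr_wpDl.
have [xI|xI] := boolP (x \in `[a, a + e]); last first.
  by rewrite bump0// normr0 mulr_ge0 ?invr_ge0 ?ltW// ltr_wpDl.
rewrite /bump normrM ger0_norm ?invr_ge0 ?(ltW e0)//.
rewrite ler_pM2l ?invr_gt0//; apply: (@le_trans _ _ M); last by rewrite lerDl.
apply: hM; move: xI; rewrite !in_itv/= -mulrBr => /andP[ax xa].
rewrite mulr_ge0 ?invr_ge0 ?(ltW e0)//=; last by lra.
by rewrite ler_pdivrMl//; lra.
Qed.

Lemma Rintegral_bump e a : 0 < e ->
  \int[mu]_(x in `[a, a + e]) bump e a x = 1.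
Proof.
move=> e0; rewrite /Rintegral (@continuous_FTC2 _ (bump e a) (scaled_step e a)).
- by rewrite -EFinB/= scaled_step1// scaled_step0// subr0.
- by rewrite ltrDl.
- by apply: continuous_subspaceT; exact: continuous_bump.
- have cS : continuous (scaled_step e a).
    move=> x; apply: differentiable_continuous; apply/derivable1_diffP.
    by case: (is_derive_scaled_step e a x).
  split.
  + by move=> x _; case: (is_derive_scaled_step e a x).
  + by apply: cvg_at_right_filter; exact: cS.
  + by apply: cvg_at_left_filter; exact: cS.
- by move=> x _; rewrite derive1_scaled_step.
Qed.

Lemma davg_lt g a r (d : R) : 0 < r -> (davg g a r < d%:E)%E ->
  (\int[mu]_(y in ball a r) `|g y - g a|%:E < (r *+ 2 * d)%:E)%E.
Proof.
move=> r0; rewrite /davg /iavg lebesgue_measure_ball ?ltW// inver.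
by rewrite mulrn_eq0/= gt_eqF// lte_pdivrMl ?mulrn_wgt0.
Qed.

(** The bump has integral 1, lives on [[a, a + e]] and is bounded by [M / e], so the
    error is at most [M / e] times the integral of [|g - g a|] over the ball of
    radius [2 e] about [a], which the Lebesgue point property makes [o(e)]. *)
Lemma bump_lebesgue_pt g a (d : R) : locally_integrable setT g ->
  lebesgue_pt g a -> 0 < d ->
  \forall e \near (0 : R)^'+, `| \int[mu]_x (g x * bump e a x) - g a| <= d.
Proof.
move=> lg La d0; have [M M0 hM] := bump_bound.
have M4 : 0 < 4 * M by rewrite mulr_gt0.
have d'0 : (0%R < (d / (4 * M))%:E)%E by rewrite lte_fin divr_gt0.
have : \forall r \near (0:R)^'+, (davg g a r < (d / (4 * M))%:E)%E.
  exact: (La _ (open_nbhs_nbhs (conj (@open_ereal_lt_ereal _ _) d'0))).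
(* The radius [2 e] is used because the closed interval [[a, a + e]] does not fit in
   the open ball of radius [e]. *)
move=> [s /= s0 hs]; exists (s / 2) => /=; first by rewrite divr_gt0.
move=> e; rewrite /ball/= sub0r normrN => es e0.
rewrite ger0_norm ?(ltW e0)// in es.
have e20 : 0 < 2 * e by rewrite mulr_gt0.
have /(davg_lt e20) I2 : (davg g a (2 * e) < (d / (4 * M))%:E)%E.
  by apply: hs => //=; rewrite sub0r normrN ger0_norm ?(ltW e20)//; lra.
have aI : `[a, a + e] `<=` ball a (2 * e).
  move=> x; rewrite /= in_itv/= => /andP[ax xe].
  by rewrite /ball/= distrC ger0_norm; lra.
have mga : measurable_fun setT (fun y => `|g y - g a|%:E).
  apply/measurable_EFinP; apply: measurableT_comp => //.
  by apply: measurable_funB => //; case: lg.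
have {}I2 : (\int[mu]_(y in `[a, (a + e)%R]) `|g y - g a|%:E < ((2 * e) *+ 2 * (d / (4 * M)))%:E)%E.
  apply: le_lt_trans I2; apply: ge0_subset_integral => //=.
  - exact: measurable_ball.
  - exact: measurable_funTS.
rewrite (Rintegral_mul_supp g (a := a) (b := a + e)); last by move=> x; exact: bump0.
have iK : mu.-integrable `[a, a + e] (EFin \o bump e a).
  apply: continuous_compact_integrable; first exact: segment_compact.
  by apply: continuous_subspaceT; exact: continuous_bump.
have igK := integrable_mul_itv a (a + e) lg (@continuous_bump e a).
rewrite -(mulr1 (g a)) -(Rintegral_bump a e0) -RintegralZl//.
have igaK : mu.-integrable `[a, a + e] (EFin \o (fun x => g a * bump e a x)).
  have -> : (EFin \o (fun x => g a * bump e a x)) =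
     (fun x => (g a)%:E * (EFin \o bump e a) x)%E by apply/funext.
  exact: integrableZl.
rewrite -RintegralB//.
have iga : mu.-integrable `[a, a + e] (EFin \o (fun x => `|g x - g a|)).
  apply/integrableP; split; first exact: measurable_funTS.
  under eq_integral do rewrite /= normr_id.
  by apply: lt_le_trans I2 _; rewrite leey.
have ire : mu.-integrable `[a, a + e] (EFin \o (fun x => (e^-1 * M) * `|g x - g a|)).
  have -> : (EFin \o (fun x => (e^-1 * M) * `|g x - g a|)) =
     (fun x => (e^-1 * M)%:E * (EFin \o (fun x => `|g x - g a|)%R) x)%E by apply/funext.
  exact: integrableZl.
have idK : mu.-integrable `[a, a + e]
    (EFin \o (fun x => g x * bump e a x - g a * bump e a x)).
  have := @integrableB _ _ R mu _ (measurable_itv _) _ _ igK igaK.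
  by apply: eq_integrable => // x _ /=; rewrite EFinB.
apply: (le_trans (le_normr_Rintegral _ _)) => //.
apply: (@le_trans _ _ (\int[mu]_(x in `[a, a + e]) ((e^-1 * M) * `|g x - g a|))).
  apply: le_Rintegral => //.
    by have := integrable_abse idK; apply: eq_integrable.
  move=> x xI; rewrite -mulrBl normrM mulrC ler_wpM2r//.
  exact: hM.
rewrite RintegralZl// /Rintegral.
have ifin : (\int[mu]_(x in `[a, (a + e)%R]) (`|g x - g a|)%:E \is a fin_num)%E.
  exact: (integrable_fin_num _ iga).
rewrite -(fineK ifin) lte_fin in I2.
apply: (le_trans (ler_wpM2l _ (ltW I2))).
  by rewrite mulr_ge0 ?invr_ge0 ?ltW.
rewrite le_eqVlt; apply/orP; left; apply/eqP.
by field; rewrite !gt_eqF.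
Qed.

Lemma scaled_step_bump_test e a b : 0 < e -> a <= b ->
  test_function (fun x => scaled_step e a x - scaled_step e b x).
Proof.
move=> e0 ab; split.
  apply: smooth_derivable => n.
  have -> : (fun x => scaled_step e a x - scaled_step e b x) =
      (fun x => scaled_step e a x + (-1) * scaled_step e b x).
    by apply/funext => x; rewrite mulN1r.
  apply: ndiffD; first exact: smooth_scaled_step.
  by apply: ndiffM; [exact: ndiff_cst|exact: smooth_scaled_step].
apply: (@subclosed_compact _ _ `[a, b + e]).
- exact: closed_closure.
- exact: segment_compact.
- have cl : closed `[a, b + e]%classic by exact: itv_closed.
  rewrite [X in _ `<=` X](iffLR (closure_id _) cl).
  apply: closure_subset => x /=; rewrite in_itv/=; apply: contraNT.
  rewrite negb_and -!ltNge => /orP[xa|xb].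
    by rewrite !scaled_step0 ?subr0//; lra.
  by rewrite !scaled_step1 ?subrr//; lra.
Qed.

(** Testing against the difference of two steps based at Lebesgue points [a] and [b]
    equates the averages of [g] near [a] and near [b]; in the limit [g a = g b].
    Almost every point is a Lebesgue point. *)
Theorem du_bois_reymond g : locally_integrable setT g ->
  (forall phi, test_function phi -> \int[mu]_x (g x * derive1 phi x) = 0) ->
  exists c : R, {ae mu, forall x, g x = c}.
Proof.
move=> lg h0.
have leq a b : a <= b -> lebesgue_pt g a -> lebesgue_pt g b -> g a = g b.
  move=> ab La Lb; apply/eqP; rewrite -subr_eq0 -normr_le0.
  apply/ler_addgt0Pr => d d0; rewrite add0r.
  have d20 : 0 < d / 2 by rewrite divr_gt0.
  have [e [/= e0 ha hb]] : exists e, [/\ 0 < e,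
      `| \int[mu]_x (g x * bump e a x) - g a| <= d / 2 &
      `| \int[mu]_x (g x * bump e b x) - g b| <= d / 2].
    near (0 : R)^'+ => e; exists e; split; first by [].
      by near: e; exact: bump_lebesgue_pt.
    by near: e; exact: bump_lebesgue_pt.
  have := h0 _ (scaled_step_bump_test e0 ab).
  have -> : derive1 (fun x => scaled_step e a x - scaled_step e b x) =
     (fun x => bump e a x - bump e b x).
    apply/funext => x; rewrite derive1E.
    by case: (is_deriveB (is_derive_scaled_step e a x)
       (is_derive_scaled_step e b x)).
  under eq_Rintegral do rewrite mulrBr.
  rewrite RintegralB//; last 2 first.
  - apply: (integrable_mul_supp lg (@continuous_bump e a)) => x.
    exact: bump0.
  - apply: (integrable_mul_supp lg (@continuous_bump e b)) => x.
    exact: bump0.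
  move=> /eqP; rewrite subr_eq0 => /eqP eab.
  rewrite eab in ha; rewrite (splitr d).
  have -> : g a - g b = (\int[mu]_x (g x * bump e b x) - g b) -
      (\int[mu]_x (g x * bump e b x) - g a).
    by rewrite [RHS]addrC opprB addrA subrK.
  by apply: (le_trans (ler_normB _ _)); exact: lerD.
have := lebesgue_differentiation lg => aeL.
have [b Lb] : exists b, lebesgue_pt g b.
  apply: contrapT => nL.
  have : mu.-negligible `[0%R, 1%R].
    by apply: negligibleS aeL => x _ /= Lx; apply: nL; exists x.
  move/(@negligibleP _ _ R mu _ (measurable_itv _)).
  rewrite /= lebesgue_measure_itv/= lte_fin ltr01 oppr0 adde0 => /eqP.
  by rewrite eqe oner_eq0.
exists (g b); apply: negligibleS aeL => x /= + Lx; apply.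
by have [xb|/ltW bx] := leP x b; [exact: leq|apply/esym; exact: leq].
Unshelve. all: by end_near. Qed.

End DuBoisReymond.

(** * The staircase is the displacement *)
Definition staircase (R : realType) (s : seq R) (x : R) : R :=
  \sum_(a <- s) (Num.floor (x - a))%:~R.

Section Staircase.
Context {R : realType}.
Local Notation mu := (@lebesgue_measure R).
Implicit Types (f g h phi : R -> R) (s : seq R).

Lemma staircase_nondecreasing s : {homo staircase s : x y / x <= y}.
Proof.
move=> x y xy; apply: ler_sum => a _.
by rewrite ler_int; apply: le_floor; rewrite lerB.
Qed.

(** Every function whose local integrability is needed below (floors, Heaviside
    steps, staircases and their translates) is monotone. *)
Lemma nondecreasing_locally_integrable f :
  {homo f : x y / x <= y} -> locally_integrable setT f.
Proof.
move=> ndf.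
have mf : measurable_fun setT f by exact: nondecreasing_measurable.
split => //; first exact: openT.
move=> K _ cK.
have [M M0 hM] := pinfty_ex_gt0 (compact_bounded cK).
have mK : measurable K by exact: compact_measurable.
pose B := Num.max `|f (- M)| `|f M|.
apply: (@le_lt_trans _ _ (\int[mu]_(x in K) cst B%:E x)%E).
  apply: ge0_le_integral => //=.
  - by apply/measurable_EFinP; apply: measurableT_comp => //; exact: measurable_funTS.
  - move=> x Kx; rewrite lee_fin.
    have /andP[/ndf f1 /ndf f2] : - M <= x <= M.
      by rewrite -ler_norml; exact: hM.
    rewrite /B le_max; have [h|h] := leP 0 (f x).
      by apply/orP; right; rewrite ger0_norm// (le_trans f2)// ler_norm.
    apply/orP; left; rewrite ltr0_norm// (@le_trans _ _ (- f (- M)))//.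
      by rewrite lerN2.
    by rewrite -normrN ler_norm.
rewrite integral_cst//=.
by rewrite lte_mul_pinfty ?lee_fin ?le_max ?normr_ge0//; exact: compact_finite_measure.
Qed.

Lemma eq0_outside phi (c y : R) : fun_supp phi `<=` `[- c, c] ->
  c < `|y| -> phi y = 0.
Proof.
move=> hc cy; apply: fun_suppP => /hc; rewrite /= in_itv/= -ler_norml.
by rewrite leNgt cy.
Qed.

(** Bundling local integrability with the value of the integral makes the relation
    stable under sums, so that the integral against a staircase is assembled from
    Heaviside steps without integrability side conditions. *)
Definition pairing phi h (v : R) :=
  locally_integrable setT h /\ \int[mu]_x (h x * derive1 phi x) = v.

Section Pairing.
Variable phi : R -> R.
Hypothesis tphi : test_function phi.

Lemma integrable_mul_derive1 h : locally_integrable setT h ->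
  mu.-integrable setT (EFin \o (fun x => h x * derive1 phi x)).
Proof.
move=> lh; have [c c0 hc] := test_support tphi.
apply: (integrable_mul_supp lh (test_derive1_continuous tphi) (a := - c) (b := c)).
by move=> x /negP xc; apply: derive1_supp => /hc.
Qed.

Lemma pairingD f g u v : pairing phi f u -> pairing phi g v ->
  pairing phi (f \+ g) (u + v).
Proof.
move=> [lf fu] [lg gv]; split; first exact: locally_integrableD.
under eq_Rintegral do rewrite /= mulrDl.
by rewrite RintegralD ?fu ?gv//; exact: integrable_mul_derive1.
Qed.

Lemma pairingZ f u (k : R) : pairing phi f u ->
  locally_integrable setT (fun x => k * f x) ->
  pairing phi (fun x => k * f x) (k * u).
Proof.
move=> [lf fu] lkf; split => //.
under eq_Rintegral do rewrite /= -mulrA.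
by rewrite RintegralZl ?fu//; exact: integrable_mul_derive1.
Qed.

Lemma locally_integrable_cst (k : R) : locally_integrable setT (fun _ : R => k).
Proof. exact: nondecreasing_locally_integrable. Qed.

Lemma test_continuous : continuous phi.
Proof.
move=> x; apply: differentiable_continuous; apply/derivable1_diffP.
by case: (test_is_derive tphi x).
Qed.

Lemma Rintegral_derive1 a b : a < b ->
  \int[mu]_(x in `[a, b]) derive1 phi x = phi b - phi a.
Proof.
move=> ab; rewrite /Rintegral (@continuous_FTC2 _ _ phi) ?EFinB//.
- by apply: continuous_subspaceT; exact: test_derive1_continuous.
- split.
  + by move=> x _; case: (test_is_derive tphi x).
  + by apply: cvg_at_right_filter; exact: test_continuous.
  + by apply: cvg_at_left_filter; exact: test_continuous.
Qed.

Lemma pairing_cst (k : R) : pairing phi (fun=> k) 0.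
Proof.
split; first exact: locally_integrable_cst.
have [c c0 hc] := test_support tphi.
rewrite (Rintegral_mul_supp (fun=> k) (a := - (c + 1)) (b := c + 1)); last first.
  move=> x /negP xc; apply: derive1_supp => /hc; apply: contra_not xc.
  by rewrite /= !in_itv/= => /andP[? ?]; apply/andP; split; lra.
have i1 : mu.-integrable `[- (c + 1), c + 1] (EFin \o derive1 phi).
  apply: continuous_compact_integrable; first exact: segment_compact.
  by apply: continuous_subspaceT; exact: test_derive1_continuous.
rewrite RintegralZl// Rintegral_derive1; last by lra.
have c1 : 0 <= c + 1 by lra.
by rewrite !(eq0_outside hc) ?normrN ?ger0_norm ?subrr ?mulr0//; lra.
Qed.

Lemma pairing_step t : pairing phi (fun x => (t <= x)%R%:R) (- phi t).
Proof.
split.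
  apply: nondecreasing_locally_integrable => x y xy.
  by rewrite ler_nat; case: (leP t x) => // tx; rewrite (le_trans tx xy).
have [c c0 hc] := test_support tphi.
pose M := Num.max c t + 1.
have Mc : c < M by rewrite /M ltr_pwDr// le_max lexx.
have Mt : t < M by rewrite /M ltr_pwDr// le_max lexx orbT.
have -> : (fun x => (t <= x)%R%:R * derive1 phi x) =
    ((derive1 phi : R -> R) \_ `[t, M]).
  apply/funext => x; rewrite patchE; case: ifPn => xI.
    by move: xI; rewrite inE/= in_itv/= => /andP[-> _]; rewrite mul1r.
  have [tx|tx] := leP t x; last by rewrite mul0r.
  rewrite mul1r; apply: derive1_supp => /hc; rewrite /= in_itv/= => /andP[_ xc].
  move: xI; rewrite notin_setE; apply; rewrite /= in_itv/= tx/=.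
  by apply: le_trans xc _; exact: ltW.
rewrite -Rintegral_mkcond Rintegral_derive1// (@eq0_outside _ _ M hc) ?sub0r//.
by rewrite ger0_norm// ltW// (lt_trans c0).
Qed.

Lemma pairing_sum (I : Type) (r : seq I) (F : I -> R -> R) (v : I -> R) :
  (forall i, pairing phi (F i) (v i)) ->
  pairing phi (fun x => \sum_(i <- r) F i x) (\sum_(i <- r) v i).
Proof.
move=> hF; elim: r => [|i r IH].
  rewrite big_nil; have -> : (fun x => \sum_(i <- [::]) F i x) = (fun=> 0).
    by apply/funext => x; rewrite big_nil.
  exact: pairing_cst.
have -> : (fun x => \sum_(j <- i :: r) F j x) =
   (F i \+ (fun x => \sum_(j <- r) F j x)).
  by apply/funext => x; rewrite big_cons.
by rewrite big_cons; exact: pairingD.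
Qed.

Lemma eq_pairing f g v : locally_integrable setT g ->
  {in fun_supp phi, f =1 g} -> pairing phi f v -> pairing phi g v.
Proof.
move=> lg fg [lf <-]; split => //; apply: eq_Rintegral => x _.
have [xs|xs] := pselect (fun_supp phi x).
  by rewrite fg//; exact/mem_set.
by rewrite derive1_supp ?mulr0.
Qed.

End Pairing.

(** This reduces the floor, on a bounded range, to Heaviside steps, whose integral
    against [phi'] is minus the value of [phi] at the step. *)
Lemma floor_sum_steps (n : nat) (y : R) : 0 <= y < n%:R ->
  \sum_(i < n) (i.+1%:R <= y)%R%:R = (Num.floor y)%:~R :> R.
Proof.
move=> /andP[y0 yn].
have : 0 <= Num.floor y by rewrite floor_ge0.
case E : (Num.floor y) => [m|//] _.
have mn : (m <= n)%N.
  rewrite ltnW// -(ltr_nat R); apply: le_lt_trans yn.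
  by have := floor_le y; rewrite E.
have -> : \sum_(i < n) (i.+1%:R <= y)%R%:R = \sum_(i < n) (i < m)%N%:R :> R.
  apply: eq_bigr => i _; congr (_%:R); congr nat_of_bool.
  by have := floor_ge_int y i.+1%:Z; rewrite E.
have -> : \sum_(i < n) (i < m)%N%:R = (minn n m)%:R :> R.
  elim: n {yn mn} => [|n IH]; first by rewrite big_ord0 min0n.
  rewrite big_ord_recr/= IH -natrD; congr (_%:R).
  by case: (ltnP n m) => nm; lia.
by rewrite (minn_idPr mn).
Qed.

(** On [[a - K, a + K]], which contains the support of [phi] with room to spare,
    [floor (x - a)] is [- K] plus steps at the points [a - K + i + 1]. *)
Lemma pairing_floor phi (c a : R) (K : nat) : test_function phi ->
  fun_supp phi `<=` `[- c, c] -> 0 <= a < 1 -> c + 1 < K%:R ->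
  pairing phi (fun x => (Num.floor (x - a))%:~R)
    (- \sum_(i < K.*2) phi (a - K%:R + i.+1%:R)).
Proof.
move=> tphi hc /andP[a0 a1] cK.
have h1 := pairing_cst tphi (- K%:R).
have h2 := pairing_sum tphi (index_enum 'I_K.*2)
  (fun i => pairing_step tphi (a - K%:R + i.+1%:R)).
have := pairingD tphi h1 h2; rewrite add0r sumrN.
apply: eq_pairing.
  apply: nondecreasing_locally_integrable => x y xy.
  by rewrite ler_int le_floor// lerB.
move=> x /set_mem/hc; rewrite /= in_itv/= => /andP[cx xc].
have K2 : K.*2%:R = K%:R + K%:R :> R by rewrite -addnn natrD.
have /floor_sum_steps : 0 <= x - a + K%:R < K.*2%:R by rewrite K2; lra.
have -> : Num.floor (x - a + K%:R) = Num.floor (x - a) + K%:Z.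
  by rewrite floorDrz ?natr_int// -[K%:R]/((Posz K)%:~R) intrKfloor.
rewrite rmorphD/= => E.
rewrite [X in _ + X](_ : _ = (Num.floor (x - a))%:~R + K%:R) 1?addrC ?addrK// -E.
by apply: eq_bigr => i _; congr (_%:R); congr nat_of_bool; lra.
Qed.

(** The points of the periodization are enumerated without repetition. *)
Lemma frac_nat_inj (a b : R) (i j : nat) : 0 <= a < 1 -> 0 <= b < 1 ->
  a + i%:R = b + j%:R -> i = j /\ a = b.
Proof.
move=> a01 b01 E; suff ij : i = j by move: E; rewrite ij => /addIr ->.
have [ij|ji|//] := ltngtP i j.
- have : i%:R + 1 <= j%:R :> R by rewrite natr1 ler_nat.
  by move=> ?; exfalso; lra.
- have : j%:R + 1 <= i%:R :> R by rewrite natr1 ler_nat.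
  by move=> ?; exfalso; lra.
Qed.

Section Displacement.
Variables (N : nat) (s : seq R) (lambda : R).
Hypothesis us : uniq s.
Hypothesis s01 : forall a, a \in s -> 0 <= a < 1.
Hypothesis lam0 : 0 < lambda.
Hypothesis N0 : (0 < N)%N.
Local Notation X := [set` s].

Let h0 (x : R) := - (lambda / N%:R) * staircase s x.

Lemma locally_integrable_displacement : locally_integrable setT h0.
Proof.
have -> : h0 = (\- (fun x => (lambda / N%:R) * staircase s x)).
  by apply/funext => x; rewrite /h0 mulNr.
apply: locally_integrableN; apply: nondecreasing_locally_integrable => x y xy.
rewrite ler_pM2l ?staircase_nondecreasing//; by rewrite divr_gt0// ltr0n.
Qed.

Lemma Rintegral_displacement phi (c : R) (K : nat) : test_function phi ->
  fun_supp phi `<=` `[- c, c] -> c + 1 < K%:R ->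
  \int[mu]_x (h0 x * derive1 phi x) =
  lambda / N%:R * \sum_(a <- s) \sum_(i < K.*2) phi (a - K%:R + i.+1%:R).
Proof.
move=> tphi hc cK.
pose F a := if a \in s then (fun x : R => (Num.floor (x - a))%:~R : R) else (fun=> 0).
pose v a := if a \in s then (- \sum_(i < K.*2) phi (a - K%:R + i.+1%:R)) else 0.
have hF a : pairing phi (F a) (v a).
  rewrite /F /v; case: ifPn => [/s01 as01|_]; last exact: pairing_cst.
  exact: (pairing_floor tphi hc).
have := pairing_sum tphi s hF.
have -> : (fun x => \sum_(i <- s) F i x) = staircase s.
  apply/funext => x; rewrite /staircase; apply: eq_big_seq => a sa.
  by rewrite /F sa.
move=> /(pairingZ tphi)/(_ locally_integrable_displacement)[_ ->].
rewrite mulNr -mulrN -sumrN; congr (_ * _); apply: eq_big_seq => a sa.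
by rewrite /v sa opprK.
Qed.

(** Only translates by integers between [1 - K] and [K] can meet the support of
    [phi]. *)
Lemma fsum_periodization phi (c : R) (K : nat) :
  fun_supp phi `<=` `[- c, c] -> c + 1 < K%:R ->
  \sum_(y \in periodization X) phi y =
  \sum_(a <- s) \sum_(i < K.*2) phi (a - K%:R + i.+1%:R).
Proof.
move=> hc cK.
pose t := [seq a - K%:R + (i.+1)%:R | a <- s, i <- iota 0 K.*2].
have ut : uniq t.
  apply: allpairs_uniq => //; first exact: iota_uniq.
  move=> [a i] [b j] /allpairsP[[a' i'] /= [/s01/andP[a0 a1] _ [ea _]]].
  move=> /allpairsP[[b' j'] /= [/s01/andP[b0 b1] _ [eb _]]] /= E.
  have [ij ab] : i = j /\ a = b.
    apply: frac_nat_inj; rewrite ?ea ?eb ?a0 ?a1 ?b0 ?b1//.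
    by move: E; rewrite ea eb -!natr1 => E; lra.
  by rewrite ij ab.
have -> : \sum_(y \in periodization X) phi y = \sum_(y \in [set` t]) phi y.
  apply/esym/fsbig_widen.
    move=> _ /= /allpairsP[[a i] /= [sa _ ->]]; exists a => //.
    exists (i.+1%:Z - K%:Z); rewrite rmorphB/= -!pmulrn -addrA; congr (_ + _).
    by rewrite addrC.
  move=> _ [[a /= sa [k ->]] /= nt]; apply: contrapT => p0.
  have /andP[a0 a1] := s01 sa.
  have : `|a + k%:~R| <= c.
    by rewrite leNgt; apply/negP => /(eq0_outside hc)/p0.
  rewrite ler_norml => /andP[ck kc].
  apply: nt; apply/allpairsP.
  have k1 : - (Posz K) < k by rewrite -(ltr_int R) rmorphN/= -pmulrn; lra.
  have k2 : k < K by rewrite -(ltr_int R) -pmulrn; lra.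
  exists (a, (absz (k + K%:Z - 1)%R)); split => //=.
    by rewrite mem_iota/= add0n -addnn; clear -k1 k2; lia.
  have -> : (absz (k + K%:Z - 1)%R).+1%:R = k%:~R + K%:R :> R.
    rewrite pmulrn [K%:R]pmulrn -rmorphD/=; congr (_%:~R).
    by lia.
  by ring.
rewrite -fsbig_seq// /t big_allpairs_dep/=; apply: eq_bigr => a _.
by rewrite -[X in iota 0 X]subn0 -/(index_iota 0 K.*2) big_mkord.
Qed.

(** A staircase has bounded variation on a bounded set because only finitely many
    steps meet it, and their number bounds the integral when [|phi| <= 1]. *)
Lemma displacement_isP : is_displacement lambda N X h0.
Proof.
split; last first.
  move=> phi tphi; have [c c0 hc] := test_support tphi.
  have cK : c + 1 < (Num.bound (c + 1))%:R.
    by apply: archi_boundP; rewrite addr_ge0// ltW.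
  by rewrite (Rintegral_displacement tphi hc cK) (fsum_periodization hc cK) mulNr.
split; first exact: locally_integrable_displacement.
move=> A oA /pinfty_ex_gt0[c c0 hA].
have cK : c + 1 < (Num.bound (c + 1))%:R.
  by apply: archi_boundP; rewrite addr_ge0// ltW.
set K := Num.bound (c + 1) in cK.
exists (lambda / N%:R * \sum_(a <- s) \sum_(i < K.*2) 1) => _ [phi [tphi sA phi1 ->]].
have hc : fun_supp phi `<=` `[- c, c].
  by move=> x /sA/hA; rewrite /= in_itv/= ler_norml.
have -> : \int[mu]_(x in A) (h0 x * derive1 phi x) =
    \int[mu]_x (h0 x * derive1 phi x).
  rewrite Rintegral_mkcond; apply: eq_Rintegral => x _.
  rewrite patchE; case: ifPn => // xA; rewrite derive1_supp ?mulr0//.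
  by move=> /sA/mem_set; rewrite (negbTE xA).
rewrite (Rintegral_displacement tphi hc cK) ler_pM2l; last first.
  by rewrite divr_gt0// ltr0n.
apply: ler_sum => a _; apply: ler_sum => i _.
by apply: le_trans (phi1 _); exact: ler_norm.
Qed.

(** The difference of two solutions of the distributional equation integrates to 0
    against every [phi'], so the chosen solution differs from the staircase by a
    constant almost everywhere. *)
Lemma displacement_ae : locally_integrable setT (displacement lambda N X) /\
  exists k, {ae mu, forall x, displacement lambda N X x = h0 x + k}.
Proof.
have : is_displacement lambda N X (displacement lambda N X).
  by rewrite /displacement; apply: xgetPex; exists h0; exact: displacement_isP.
set h := displacement _ _ _ => -[[lh _] hh]; split => //.
have [[l0 _] hh0] := displacement_isP.
have [k hk] : exists k, {ae mu, forall x, (h \- h0) x = k}.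
  apply: du_bois_reymond; first exact: locally_integrableB.
  move=> phi tphi; under eq_Rintegral do rewrite /= mulrBl.
  rewrite RintegralB//; [|exact: integrable_mul_derive1..].
  have := hh _ tphi; rewrite -hh0// => /eqP; rewrite eqr_opp => /eqP ->.
  by rewrite subrr.
exists k; apply: negligibleS hk => x /= nx hx; apply: nx.
by rewrite -hx /= addrC subrK.
Qed.

End Displacement.

End Staircase.

(** * The energy does not depend on the representative *)
Section EnergyRepresentative.
Context {R : realType}.
Local Notation mu := (@lebesgue_measure R).
Implicit Types (f g h : R -> R).

(** Lebesgue measure is determined by its values on half-open intervals, which
    translation preserves. *)
Lemma lebesgue_measure_shift (y : R) (A : set R) : measurable A ->
  mu [set z | A (y + z)] = mu A.
Proof.
move=> mA; have ms : measurable_fun setT (fun z : measurableTypeR R => (y + z : measurableTypeR R)).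
  exact: measurable_funD.
apply/esym.
apply: (@lebesgue_measure_unique _
  (pushforward mu (fun z : measurableTypeR R => (y + z : measurableTypeR R)))) => //.
move=> _ /ocitvP[->|[[a b] /= ab ->]].
  by rewrite measure0.
rewrite /pushforward.
have -> : (fun z => y + z) @^-1` `]a, b] = `]a - y, b - y]%classic.
  by apply/seteqP; split => z; rewrite /= !in_itv/= => /andP[? ?]; apply/andP; split; lra.
rewrite /= !lebesgue_measure_itv/= !lte_fin ltrD2r ab -!EFinB; congr (_%:E).
by ring.
Qed.

Lemma negligible_shift (y : R) (Z : set R) : mu.-negligible Z ->
  mu.-negligible [set z | Z (y + z)].
Proof.
move=> [A [mA A0 ZA]]; exists [set z | A (y + z)]; split.
- rewrite -[X in measurable X]setTI.
  have ms : measurable_fun setT (fun z : measurableTypeR R => (y + z : measurableTypeR R)).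
    exact: measurable_funD.
  exact: ms.
- by rewrite lebesgue_measure_shift.
- by move=> z /ZA.
Qed.

Section Tonelli.
Variables (A B : set R) (F : measurableTypeR R * measurableTypeR R -> \bar R).
Hypothesis (mA : measurable A) (mB : measurable B).
Hypothesis mF : measurable_fun setT F.
Hypothesis F0 : forall x, (0%R <= F x)%E.

Lemma tonelli_in :
  (\int[mu]_(x in A) \int[mu]_(y in B) F (x, y) =
   \int[mu]_(y in B) \int[mu]_(x in A) F (x, y))%E.
Proof.
pose G := F \_ (A `*` B).
have mG : measurable_fun setT G.
  apply: (iffLR (measurable_restrictT _ (measurableX mA mB))).
  exact: measurable_funTS.
have G0 x : (0%R <= G x)%E by rewrite /G patchE; case: ifPn.
have := @fubini_tonelli _ _ _ _ R mu mu G mG G0.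
have -> : (\int[mu]_x \int[mu]_y G (x, y) =
    \int[mu]_(x in A) \int[mu]_(y in B) F (x, y))%E.
  rewrite [RHS]integral_mkcond; apply: eq_integral => x _.
  rewrite patchE; case: ifPn => xA.
    rewrite [RHS]integral_mkcond; apply: eq_integral => y _.
    by rewrite /G !patchE in_setX xA.
  by apply: integral0_eq => y _; rewrite /G patchE in_setX (negbTE xA).
move=> ->.
rewrite [RHS]integral_mkcond; apply: eq_integral => y _.
rewrite patchE; case: ifPn => yB.
  rewrite [RHS]integral_mkcond; apply: eq_integral => x _.
  by rewrite /G !patchE in_setX yB andbT.
by apply: integral0_eq => x _; rewrite /G patchE in_setX (negbTE yB) andbF.
Qed.

Lemma measurable_inner_integral :
  measurable_fun setT (fun x => \int[mu]_(y in B) F (x, y))%E.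
Proof.
pose G := F \_ (setT `*` B).
have mG : measurable_fun setT G.
  apply: (iffLR (measurable_restrictT _ (measurableX measurableT mB))).
  exact: measurable_funTS.
have G0 x : (0%R <= G x)%E by rewrite /G patchE; case: ifPn.
have := @measurable_fun_fubini_tonelli_F _ _ _ _ R mu G mG G0.
apply: eq_measurable_fun => x _; rewrite /fubini_F [RHS]integral_mkcond.
by apply: eq_integral => y _; rewrite /G !patchE in_setX in_setT.
Qed.

End Tonelli.

Lemma measurable_core_domain (rho : R) : measurable (core_domain rho).
Proof. exact: measurableU. Qed.

Definition difference_quotient h (p : measurableTypeR R * measurableTypeR R) : \bar R :=
  (`|h (p.1 + p.2) - h p.1| ^+ 2 / `|p.2| ^+ 2)%:E.

Lemma difference_quotient_ge0 h p : (0%R <= difference_quotient h p)%E.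
Proof. by rewrite lee_fin divr_ge0// sqr_ge0. Qed.

Lemma measurable_inv : measurable_fun setT (fun x : R => x^-1).
Proof.
rewrite -(setvU [set 0 : R]); apply/measurable_funU => //.
  exact: measurableC.
split; last exact: measurable_fun_set1.
apply: open_continuous_measurable_fun.
  by apply: closed_openC; exact: closed_eq.
by move=> x; rewrite inE => /eqP x0; exact: inv_continuous.
Qed.

Lemma measurable_difference_quotient h : measurable_fun setT h ->
  measurable_fun setT (difference_quotient h).
Proof.
move=> mh; apply/measurable_EFinP; apply: measurable_funM.
  apply: measurable_funX; apply: measurableT_comp => //.
  apply: measurable_funB.
    by apply: (measurableT_comp mh); exact: measurable_funD.
  exact: (measurableT_comp mh).
apply: (measurableT_comp measurable_inv).
by apply: measurable_funX; apply: measurableT_comp.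
Qed.

Lemma core_energy_swap (rho : R) h : measurable_fun setT h ->
  core_energy rho h =
  (\int[mu]_(z in core_domain rho) \int[mu]_(y in `[0%R, 1%R])
    difference_quotient h (y, z))%E.
Proof.
move=> mh.
exact: (tonelli_in (measurable_itv _) (measurable_core_domain rho)
  (measurable_difference_quotient mh) (difference_quotient_ge0 h)).
Qed.

(** For [y] off the exceptional null set [Z], the inner integrands agree except for
    [z] in [Z - y], which is again a null set; the additive constant cancels. *)
Lemma ae_core_energy (rho : R) h g (k : R) :
  measurable_fun setT h -> measurable_fun setT g ->
  {ae mu, forall x, h x = g x + k} -> core_energy rho h = core_energy rho g.
Proof.
move=> mh mg hg.
have mD := measurable_core_domain rho.
apply: ge0_ae_eq_integral => //.
- apply: measurable_funTS.
  exact: (measurable_inner_integral mD (measurable_difference_quotient mh)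
    (difference_quotient_ge0 h)).
- apply: measurable_funTS.
  exact: (measurable_inner_integral mD (measurable_difference_quotient mg)
    (difference_quotient_ge0 g)).
- by move=> y _; apply: integral_ge0 => z _; exact: (difference_quotient_ge0 h (y, z)).
- by move=> y _; apply: integral_ge0 => z _; exact: (difference_quotient_ge0 g (y, z)).
apply: (negligibleS _ hg) => y /= ny hy; apply: ny => _.
apply: ge0_ae_eq_integral => //.
- apply: measurable_funTS.
  exact: (measurableT_comp (measurable_difference_quotient mh) (measurable_pair1 y)).
- apply: measurable_funTS.
  exact: (measurableT_comp (measurable_difference_quotient mg) (measurable_pair1 y)).
apply: (negligibleS _ (negligible_shift y hg)) => z /= nz hyz; apply: nz => _.
by rewrite hy hyz opprD addrACA subrr addr0.
Qed.

End EnergyRepresentative.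

(** * Mean square of the jumps *)
Section FloorIntegrals.
Context {R : realType}.
Local Notation mu := (@lebesgue_measure R).
Implicit Types (s : seq R).

(** On a unit interval the floor jumps exactly once. *)
Lemma floorD_itv (t y : R) : 0 <= y <= 1 ->
  (Num.floor (y + t))%:~R =
  (Num.floor t)%:~R + (1 - (t - (Num.floor t)%:~R) <= y)%R%:R :> R.
Proof.
move=> /andP[y0 y1]; have /andP[f0 f1] := floor_itv t.
rewrite intrD in f1.
have [fy|yf] := leP (1 - (t - (Num.floor t)%:~R)) y.
  rewrite -[1%:R]/(1%:~R) -intrD; congr (_%:~R).
  by apply: floor_def; rewrite !intrD; lra.
rewrite addr0; congr (_%:~R).
by apply: floor_def; rewrite !intrD; lra.
Qed.

Lemma Rintegral_floor (t : R) :
  \int[mu]_(y in `[0, 1]) (Num.floor (y + t))%:~R = t.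
Proof.
have /andP[f0 f1] := floor_itv t.
rewrite intrD in f1.
set f := t - (Num.floor t)%:~R.
have -> : \int[mu]_(y in `[0, 1]) (Num.floor (y + t))%:~R =
  \int[mu]_(y in `[0, 1]) ((Num.floor t)%:~R + (1 - f <= y)%R%:R).
  by apply: eq_Rintegral => y; rewrite inE/= in_itv/= => /floorD_itv ->.
have ic (k : R) : mu.-integrable `[0%R, 1%R] (EFin \o (fun=> k)).
  by apply: locally_integrable_itv; exact: locally_integrable_cst.
rewrite RintegralD//; last first.
  apply: locally_integrable_itv; apply: nondecreasing_locally_integrable => x y xy.
  by rewrite ler_nat; case: (leP (1 - f) x) => // tx; rewrite (le_trans tx xy).
rewrite Rintegral_cst//.
have -> : \int[mu]_(y in `[0, 1]) (1 - f <= y)%R%:R =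
   \int[mu]_(y in `[0, 1] `&` `[1 - f, +oo[) (1 : R).
  rewrite Rintegral_mkcondr; apply: eq_Rintegral => y _.
  rewrite patchE; case: ifPn; rewrite ?notin_setE ?inE /= in_itv/= andbT.
    by move=> ->.
  by move=> /negP/negbTE ->.
have -> : `[0, 1] `&` `[1 - f, +oo[ = `[1 - f, 1]%classic.
  apply/seteqP; split => y; rewrite /= !in_itv/= andbT.
    by move=> [/andP[_ ->] ->].
  by move=> /andP[fy ->]; split => //; rewrite andbT; rewrite /f in fy; lra.
rewrite Rintegral_cst//= !lebesgue_measure_itv/= !lte_fin ltr01 oppr0 adde0/= mulr1 mul1r.
case: ifPn => h /=; first by rewrite /f; lra.
by move: h; rewrite -leNgt /f; lra.
Qed.

(** The signed number of points of the periodic configuration between [y] and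
    [y + z]. *)
Definition jump s (z y : R) : R := staircase s (y + z) - staircase s y.

Lemma jump_int s z y : exists k : int, jump s z y = k%:~R.
Proof.
rewrite /jump /staircase -sumrB.
exists (\sum_(a <- s) (Num.floor (y + z - a) - Num.floor (y - a))).
by rewrite rmorph_sum; apply: eq_bigr => a _; rewrite rmorphB.
Qed.

Lemma staircase_shift_nondecreasing s z : {homo (fun y => staircase s (y + z)) : x y / x <= y}.
Proof. by move=> x y xy; apply: staircase_nondecreasing; rewrite lerD2r. Qed.

Lemma integrable_jump s z : mu.-integrable `[0%R, 1%R] (EFin \o jump s z).
Proof.
apply: locally_integrable_itv; apply: locally_integrableB.
  exact: (nondecreasing_locally_integrable (@staircase_shift_nondecreasing s z)).
exact: (nondecreasing_locally_integrable (@staircase_nondecreasing _ s)).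
Qed.

Lemma integrable_nondecreasing (f : R -> R) : {homo f : x y / x <= y} ->
  mu.-integrable `[0%R, 1%R] (EFin \o f).
Proof.
by move=> h; apply: locally_integrable_itv; exact: nondecreasing_locally_integrable.
Qed.

Lemma Rintegral_staircase s z :
  \int[mu]_(y in `[0, 1]) staircase s (y + z) = \sum_(a <- s) (z - a).
Proof.
elim: s => [|a s IH].
  rewrite big_nil; under eq_Rintegral do rewrite /staircase big_nil.
  by rewrite Rintegral_cst// mul0r.
rewrite big_cons -IH -(Rintegral_floor (z - a)) -RintegralD//; last 2 first.
- apply: integrable_nondecreasing => x y xy.
  by rewrite ler_int le_floor// lerD2r.
- exact: (integrable_nondecreasing (@staircase_shift_nondecreasing s z)).
by apply: eq_Rintegral => y _; rewrite /staircase big_cons addrA.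
Qed.

(** The mean jump depends on the number of points but not on their positions: this
    is the constraint under which the mean square is minimized. *)
Lemma Rintegral_jump s z :
  \int[mu]_(y in `[0, 1]) jump s z y = (size s)%:R * z.
Proof.
rewrite /jump RintegralB//; last 2 first.
- exact: (integrable_nondecreasing (@staircase_shift_nondecreasing s z)).
- exact: (integrable_nondecreasing (@staircase_nondecreasing _ s)).
have -> : \int[mu]_(y in `[0, 1]) staircase s y = \sum_(a <- s) (0 - a).
  by rewrite -Rintegral_staircase; apply: eq_Rintegral => y _; rewrite addr0.
rewrite Rintegral_staircase -sumrB.
under eq_bigr do rewrite sub0r opprK subrK.
by rewrite big_const_seq count_predT iter_addr_0 mulr_natl.
Qed.

Lemma integrable_jump2 s z :
  mu.-integrable `[0%R, 1%R] (EFin \o (fun y => jump s z y ^+ 2)).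
Proof.
apply: measurable_bounded_integrable => //.
- by rewrite /= lebesgue_measure_itv/= lte_fin ltr01 ltry.
- apply: measurable_funX; have /integrableP[/measurable_EFinP//] := integrable_jump s z.
pose M := (`|staircase s (1 + z)| + `|staircase s z|) +
          (`|staircase s 1| + `|staircase s 0|).
have nb (u v w : R) : u <= v <= w -> `|v| <= `|w| + `|u|.
  move=> /andP[uv vw]; rewrite ler_norml; apply/andP; split.
    rewrite lerNl; apply: (@le_trans _ _ (- u)); first by rewrite lerN2.
    by rewrite -[- u]add0r lerD// -normrN ler_norm.
  by rewrite (le_trans vw)// -[w]addr0 lerD ?addr0 ?ler_norm.
exists (M ^+ 2); split; first exact: num_real.
move=> x Mx y /=; rewrite in_itv/= => /andP[y0 y1].
apply: le_trans (ltW Mx); rewrite normrX lerXn2r ?nnegrE//.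
  by rewrite /M !addr_ge0.
apply: (le_trans (ler_normB _ _)); apply: lerD; apply: nb.
  by rewrite -[X in staircase s X <= _]add0r !staircase_shift_nondecreasing.
by rewrite !staircase_nondecreasing.
Qed.

Definition mean_square_jump s z := \int[mu]_(y in `[0, 1]) (jump s z y ^+ 2).

(** The mean square of an integer-valued function of mean [N z] whose values are
    [floor (N z)] and [floor (N z) + 1]. *)
Definition balanced_mean_square (N : nat) (z : R) : R :=
  let m := (Num.floor (N%:R * z))%:~R in (2 * m + 1) * (N%:R * z) - m * (m + 1).

Lemma int_excess_ge0 (n m : int) : 0 <= (n - m) * (n - m - 1).
Proof.
have [nm|mn] := leP n m; last by rewrite mulr_ge0//; lia.
by rewrite mulr_le0//; lia.
Qed.

Lemma integrable_affine_jump s z (a b : R) :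
  mu.-integrable `[0%R, 1%R] (EFin \o (fun y => a * jump s z y + b)).
Proof.
have i1 : mu.-integrable `[0%R, 1%R] (EFin \o (fun y => a * jump s z y)).
  have -> : (EFin \o (fun y => a * jump s z y)) =
    (fun y => a%:E * (EFin \o jump s z) y)%E by apply/funext.
  by apply: integrableZl => //; exact: integrable_jump.
have ib : mu.-integrable `[0%R, 1%R] (EFin \o (fun=> b)).
  by apply: integrable_nondecreasing.
exact: (@integrableD _ _ R mu _ (measurable_itv _) _ _ i1 ib).
Qed.

Lemma excessE s z (m y : R) : (jump s z y - m) * (jump s z y - m - 1) =
  jump s z y ^+ 2 + (- (2 * m + 1) * jump s z y + m * (m + 1)).
Proof. by ring. Qed.

Lemma integrable_excess s z (m : R) : mu.-integrable `[0%R, 1%R]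
  (EFin \o (fun y => (jump s z y - m) * (jump s z y - m - 1))).
Proof.
have := @integrableD _ _ R mu _ (measurable_itv _) _ _ (integrable_jump2 s z)
  (integrable_affine_jump s z (- (2 * m + 1)) (m * (m + 1))).
by apply: eq_integrable => // y _; rewrite /= excessE EFinD.
Qed.

(** Expands [n^2 = (2 m + 1) n - m (m + 1) + (n - m) (n - m - 1)] and uses the known
    mean of the jump; only the last term depends on the configuration. *)
Lemma mean_square_jumpE s z (m : R) :
  mean_square_jump s z = (2 * m + 1) * ((size s)%:R * z) - m * (m + 1) +
   \int[mu]_(y in `[0, 1]) ((jump s z y - m) * (jump s z y - m - 1)).
Proof.
under eq_Rintegral do rewrite excessE.
rewrite RintegralD//; [|exact: integrable_jump2|exact: integrable_affine_jump].
rewrite RintegralD//; last 2 first.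
- by have := integrable_affine_jump s z (- (2 * m + 1)) 0;
    apply: eq_integrable => // y _; rewrite /= addr0.
- by apply: integrable_nondecreasing.
rewrite Rintegral_cst//= lebesgue_measure_itv/= lte_fin ltr01/=.
rewrite RintegralZl//; last exact: integrable_jump.
rewrite Rintegral_jump.
by rewrite /mean_square_jump; ring.
Qed.

(** The excess is nonnegative because jumps are integers. *)
Lemma mean_square_jump_ge s z : balanced_mean_square (size s) z <= mean_square_jump s z.
Proof.
rewrite (mean_square_jumpE s z (Num.floor ((size s)%:R * z))%:~R) lerDl.
apply: Rintegral_ge0 => y _; have [k ->] := jump_int s z y.
by rewrite -[1]/(1%:~R) -!intrB -intrM ler0z int_excess_ge0.
Qed.

(** Here [floor (N z) = 0], and the excess [n (n - 1)] is at least 2 where [n >= 2]. *)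
Lemma mean_square_jump_ge_overlap s z (p q : R) : 0 <= p -> p <= q -> q <= 1 ->
  0 <= (size s)%:R * z < 1 ->
  (forall y, p <= y < q -> 2 <= jump s z y) ->
  balanced_mean_square (size s) z + 2 * (q - p) <= mean_square_jump s z.
Proof.
move=> p0 pq q1 m0 h.
have fm : Num.floor ((size s)%:R * z) = 0 by apply: floor_def.
rewrite (mean_square_jumpE s z 0) /balanced_mean_square fm !mulr0 !mul0r !subr0 lerD2l.
have pq01 : `[p, q[ `<=` `[0%R, 1%R].
  by move=> y; rewrite /= !in_itv/= => /andP[? ?]; apply/andP; split; lra.
have -> : 2 * (q - p) = \int[mu]_(y in `[0, 1]) ((cst (2 : R)) \_ `[p, q[) y.
  rewrite -Rintegral_mkcondr setIidr// Rintegral_cst//= lebesgue_measure_itv/= lte_fin.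
  have [//|qp] := ltP p q.
  have -> : p = q by apply/eqP; rewrite eq_le pq qp.
  by rewrite subrr.
apply: le_Rintegral => //.
- apply: locally_integrable_itv; apply: integrable_locally_restrict => //.
  apply: (@integrableS _ _ R mu _ _ _ (measurable_itv _) (measurable_itv _) pq01).
  by apply: integrable_nondecreasing.
- have := integrable_excess s z 0.
  by apply: eq_integrable => // y _; rewrite /= subr0.
move=> y _; rewrite patchE; case: ifPn => [|_].
  by rewrite inE/= in_itv/= => /h; nra.
have [k ->] := jump_int s z y.
rewrite subr0; have := int_excess_ge0 k 0; rewrite subr0.
by rewrite -(ler_int R) intrM intrB.
Qed.

End FloorIntegrals.

(** * The equispaced configuration *)
Section Equispaced.
Context {R : realType}.
Local Notation mu := (@lebesgue_measure R).
Variable N : nat.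
Hypothesis N0 : (0 < N)%N.

Definition equispaced : seq R := [seq i%:R / N%:R | i <- iota 0 N].

Lemma size_equispaced : size equispaced = N.
Proof. by rewrite size_map size_iota. Qed.

(** Translation by [1/N] permutes the points cyclically; the one that wraps around
    contributes one more unit. *)
Lemma staircase_equispacedS (x : R) :
  staircase equispaced (x + N%:R^-1) = staircase equispaced x + 1.
Proof.
have Nn0 : N%:R != 0 :> R by rewrite pnatr_eq0 -lt0n.
rewrite /staircase /equispaced !big_map -[X in iota 0 X]subn0 -/(index_iota 0 N).
case: N Nn0 => [|n Nn0]; first by rewrite eqxx.
rewrite big_nat_recl// [in RHS]big_nat_recr//=.
have -> : Num.floor (x + n.+1%:R^-1 - 0%:R / n.+1%:R) =
    Num.floor (x - n%:R / n.+1%:R) + 1.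
  have -> : x + n.+1%:R^-1 - 0%:R / n.+1%:R = (x - n%:R / n.+1%:R) + 1.
    by rewrite -natr1 in Nn0 *; field.
  by rewrite floorDrz ?rpred1// floor1.
rewrite rmorphD/= [LHS]addrC addrA; congr (_ + _ + _).
apply: eq_bigr => i _; congr (Num.floor _)%:~R.
by rewrite -!natr1 in Nn0 *; field.
Qed.

Lemma staircase_equispacedD (x : R) (k : int) :
  staircase equispaced (x + k%:~R / N%:R) = staircase equispaced x + k%:~R.
Proof.
have stepn (n : nat) (u : R) :
    staircase equispaced (u + n%:R / N%:R) = staircase equispaced u + n%:R.
  elim: n => [|n IH]; first by rewrite mul0r !addr0.
  by rewrite -natr1 mulrDl mul1r addrA staircase_equispacedS IH addrA.
case: k => n; first exact: stepn.
rewrite NegzE rmorphN/= -pmulrn.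
have := stepn n.+1 (x - n.+1%:R / N%:R); rewrite subrK mulNr => ->.
by rewrite addrK.
Qed.

(** Write [z] as [m / N + r] with [0 <= r <= 1/N]: translation by [m / N] adds
    exactly [m] to the staircase and translation by [r] adds between 0 and 1, so
    every jump is [m] or [m + 1] and the excess vanishes. *)
Lemma mean_square_jump_equispaced z : mean_square_jump equispaced z = balanced_mean_square N z.
Proof.
have Np : 0 < N%:R :> R by rewrite ltr0n.
set m := Num.floor (N%:R * z).
rewrite (mean_square_jumpE _ z m%:~R) size_equispaced -[RHS]addr0; congr (_ + _).
rewrite -[RHS](@Rintegral_set0 _ _ R mu (fun=> 0)).
have -> : \int[mu]_(y in `[0, 1])
    ((jump equispaced z y - m%:~R) * (jump equispaced z y - m%:~R - 1)) =
    \int[mu]_(y in `[0, 1]) (0 : R); last first.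
  by rewrite Rintegral_cst// mul0r Rintegral_set0.
apply: eq_Rintegral => y _.
have /andP[mz zm] := floor_itv (N%:R * z); rewrite -/m intrD in mz zm.
have mz' : m%:~R / N%:R <= z by rewrite ler_pdivrMr// mulrC.
have zm' : z <= m%:~R / N%:R + N%:R^-1.
  by rewrite -[X in _ + X]mul1r -mulrDl ler_pdivlMr// mulrC ltW.
have lo : m%:~R <= jump equispaced z y.
  rewrite /jump lerBrDl -staircase_equispacedD; apply: staircase_nondecreasing.
  by rewrite lerD2l.
have hi : jump equispaced z y <= m%:~R + 1.
  rewrite /jump lerBlDl addrA -staircase_equispacedD -staircase_equispacedS.
  by apply: staircase_nondecreasing; rewrite -addrA lerD2l.
have [k jk] := jump_int equispaced z y; rewrite jk in lo hi *.
rewrite ler_int in lo; rewrite -[1]/(1%:~R) -intrD ler_int in hi.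
have [->|mk] := eqVneq k m; first by rewrite subrr mul0r.
have -> : k = m + 1 by lia.
by rewrite intrD; ring.
Qed.

Lemma uniq_equispaced : uniq equispaced.
Proof.
have Nn0 : N%:R^-1 != 0 :> R by rewrite invr_eq0 pnatr_eq0 -lt0n.
rewrite map_inj_uniq ?iota_uniq// => i j /(mulIf Nn0)/eqP.
by rewrite eqr_nat => /eqP.
Qed.

Lemma equispaced01 a : a \in equispaced -> 0 <= a < 1.
Proof.
have Np : 0 < N%:R :> R by rewrite ltr0n.
move=> /mapP[i]; rewrite mem_iota/= add0n => iN ->.
by rewrite divr_ge0//= ltr_pdivrMr// mul1r ltr_nat.
Qed.

Lemma circle_dist_equispaced a b : a \in equispaced -> b \in equispaced ->
  a <> b -> N%:R^-1 <= circle_dist a b.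
Proof.
have Np : 0 < N%:R :> R by rewrite ltr0n.
move=> /mapP[i]; rewrite mem_iota/= add0n => iN ->.
move=> /mapP[j]; rewrite mem_iota/= add0n => jN -> ab.
have {}ab : i <> j by move=> h; apply: ab; rewrite h.
rewrite /circle_dist -mulrBl normrM (ger0_norm (_ : 0 <= N%:R^-1)) ?invr_ge0//.
wlog ij : i j iN jN ab / (i < j)%N.
  move=> h; have [ij|ji|//] := ltngtP i j; first exact: h.
  by rewrite distrC; apply: h => // E; exact: ab.
rewrite distrC -natrB 1?ltnW// normr_nat le_min; apply/andP; split.
  by rewrite ler_peMl ?invr_ge0// ler1n subn_gt0.
rewrite lerBrDr -[X in X + _]mul1r -mulrDl ler_pdivrMr// mul1r nat1r ler_nat.
lia.
Qed.

End Equispaced.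

(** * Comparison of energies *)
Section Energy.
Context {R : realType}.
Local Notation mu := (@lebesgue_measure R).
Implicit Types (s : seq R).

(** A lattice translate of [x] between [y] and [y + z] is counted by the difference
    of floors. *)
Lemma floor_gap (x y z : R) (k : int) : y < x + k%:~R -> x + k%:~R <= y + z ->
  1 <= (Num.floor (y + z - x))%:~R - (Num.floor (y - x))%:~R :> R.
Proof.
move=> yx xz.
have h1 : Num.floor (y - x) < k by rewrite floor_lt_int; lra.
have h2 : k <= Num.floor (y + z - x) by rewrite floor_ge_int; lra.
by rewrite -intrB -[1]/(1%:~R) ler_int; lia.
Qed.

Lemma jump_ge2 s (a b y z : R) (i j : int) : a \in s -> b \in s -> a != b ->
  0 <= z -> y < a + i%:~R -> a + i%:~R <= y + z ->
  y < b + j%:~R -> b + j%:~R <= y + z -> 2 <= jump s z y.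
Proof.
move=> sa sb ab z0 ya az yb bz.
rewrite /jump /staircase -sumrB (big_rem a)//=.
have bs : b \in rem a s by apply: rem_mem => //; rewrite eq_sym.
rewrite (big_rem b)//= -[2]/(1 + 1) -[X in X <= _]addr0 -addrA.
apply: lerD; first exact: floor_gap ya az.
apply: lerD; first exact: floor_gap yb bz.
apply: sumr_ge0 => x _; rewrite subr_ge0 ler_int le_floor//.
by rewrite lerD2r lerDl.
Qed.

(** A window of length [z >= z1] that starts in [[p, q)] contains translates of
    both [a] and [b].  The three cases are: the short arc is [[a, b]] and windows may
    start to the left of [a]; the same with [a = 0], where they start to the left of
    [1]; the short arc passes through [0], from [b] to [a + 1]. *)
Lemma close_pair_overlap s (a b z1 : R) : a \in s -> b \in s ->
  0 <= a -> a < b -> b < 1 -> circle_dist a b < z1 -> z1 < 1 ->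
  exists p q, [/\ 0 <= p, p < q, q <= 1 &
    forall z y, z1 <= z -> p <= y < q -> 2 <= jump s z y].
Proof.
move=> sa sb a0 ab b1.
rewrite /circle_dist ler0_norm ?opprB ?subr_le0 1?ltW//; move=> + z11.
have abn : a != b by rewrite lt_eqF.
rewrite gt_min => /orP[dz|dz].
  have [a_gt0|a_le0] := ltP 0 a.
    exists (Num.max 0 (b - z1)), a; split.
    - by rewrite le_max lexx.
    - by rewrite gt_max a_gt0/=; lra.
    - by lra.
    move=> z y zz /andP[]; rewrite ge_max => /andP[y0 yb] ya.
    by apply: (@jump_ge2 _ a b _ _ 0 0) => //; rewrite ?addr0; lra.
  exists (1 + b - z1), 1; split; try lra.
  move=> z y zz /andP[yb ya].
  by apply: (@jump_ge2 _ a b _ _ 1 1) => //; rewrite ?mulr1z ?mulr0z; lra.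
exists (a + 1 - z1), b; split; try lra.
move=> z y zz /andP[yb ya].
by apply: (@jump_ge2 _ a b _ _ 1 0) => //; rewrite ?mulr1z ?mulr0z ?addr0; lra.
Qed.

Variables (N : nat) (rho c : R).
Hypothesis N0 : (0 < N)%N.
Hypothesis rho0 : 0 < rho.
Hypothesis rhoN : rho < N%:R^-1.
Hypothesis c0 : 0 < c.

Let H s (x : R) := - c * staircase s x.
Let W (z : R) := c ^+ 2 / `|z| ^+ 2.

Let W_ge0 z : 0 <= W z.
Proof. by rewrite divr_ge0// sqr_ge0. Qed.

Lemma measurable_H s : measurable_fun setT (H s).
Proof.
apply: measurable_funM => //.
by apply: nondecreasing_measurable => //; exact: staircase_nondecreasing.
Qed.

(** Tonelli reduces the energy to the weight [W z] times the mean square of the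
    jumps of length [z]. *)
Lemma inner_energy s z : (\int[mu]_(y in `[0%R, 1%R])
    difference_quotient (H s) (y, z) = (W z * mean_square_jump s z)%:E)%E.
Proof.
rewrite /mean_square_jump -RintegralZl//; last exact: integrable_jump2.
have iW : mu.-integrable `[0%R, 1%R] (EFin \o (fun y => W z * jump s z y ^+ 2)).
  have -> : (EFin \o (fun y => W z * jump s z y ^+ 2)) =
    (fun y => (W z)%:E * (EFin \o (fun y => jump s z y ^+ 2)%R) y)%E by apply/funext.
  by apply: integrableZl => //; exact: integrable_jump2.
rewrite /Rintegral fineK; last exact: (integrable_fin_num _ iW).
apply: eq_integral => y _; rewrite /difference_quotient/=; congr (_%:E).
rewrite /H /W /jump -mulrBr normrM exprMn normrN.
by rewrite !real_normK ?num_real//; ring.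
Qed.

Lemma core_energyE s : core_energy rho (H s) =
  (\int[mu]_(z in core_domain rho) (W z * mean_square_jump s z)%:E)%E.
Proof.
rewrite core_energy_swap; last exact: measurable_H.
by apply: eq_integral => z _; rewrite inner_energy.
Qed.

Lemma measurable_inner_energy s :
  measurable_fun setT (fun z => (W z * mean_square_jump s z)%:E).
Proof.
have -> : (fun z => (W z * mean_square_jump s z)%:E) = (fun z => \int[mu]_(y in `[0%R, 1%R])
    (difference_quotient (H s) \o (fun p => (p.2, p.1))) (z, y))%E.
  by apply/funext => z; rewrite inner_energy.
apply: measurable_inner_integral => //.
  apply: (measurableT_comp (measurable_difference_quotient (measurable_H s))).
  exact: measurable_swap.
by move=> p; exact: difference_quotient_ge0.
Qed.

Lemma core_energy_equispaced_le s : size s = N ->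
  (core_energy rho (H (equispaced N)) <= core_energy rho (H s))%E.
Proof.
move=> sN; rewrite !core_energyE; apply: ge0_le_integral => //.
- exact: measurable_core_domain.
- by move=> z _; rewrite lee_fin mulr_ge0// Rintegral_ge0// => y _; exact: sqr_ge0.
- by apply: measurable_funTS; exact: measurable_inner_energy.
- by apply: measurable_funTS; exact: measurable_inner_energy.
move=> z _; rewrite lee_fin ler_wpM2l// mean_square_jump_equispaced// -sN.
exact: mean_square_jump_ge.
Qed.

(** The truncation at [rho] keeps the weight bounded, and the mean square is at most
    quadratic in [N] since [|z| <= 1]. *)
Lemma core_energy_equispaced_fin :
  (core_energy rho (H (equispaced N)) < +oo)%E.
Proof.
have r0 := rho0; pose C : R := c ^+ 2 / rho ^+ 2 * ((2 * N%:R + 1) * N%:R + N%:R * (N%:R + 1)).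
have D12 : core_domain rho `<=` `[- 2^-1, 2^-1].
  by move=> z [] /=; rewrite !in_itv/= => /andP[? ?]; apply/andP; split; lra.
have muD : (mu (core_domain rho) < +oo)%E.
  apply: (@le_lt_trans _ _ (mu `[- 2^-1, 2^-1])).
    by apply: le_measure => //; rewrite inE//; exact: measurable_core_domain.
  by rewrite /= lebesgue_measure_itv/=; case: ifPn => // _; rewrite -EFinB ltry.
rewrite core_energyE.
apply: (@le_lt_trans _ _ (\int[mu]_(z in core_domain rho) cst C%:E z)%E); last first.
  rewrite integral_cst//; last exact: measurable_core_domain.
  rewrite lte_mul_pinfty// lee_fin /C; apply: mulr_ge0.
    by rewrite divr_ge0 ?sqr_ge0.
  by rewrite addr_ge0 ?mulr_ge0 ?addr_ge0 ?mulr_ge0.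
apply: ge0_le_integral => //.
- exact: measurable_core_domain.
- by move=> z _; rewrite lee_fin mulr_ge0// Rintegral_ge0// => y _; exact: sqr_ge0.
- by apply: measurable_funTS; exact: measurable_inner_energy.
move=> z Dz; rewrite lee_fin mean_square_jump_equispaced//.
have zr : rho <= `|z|.
  by rewrite ler_normr; case: Dz => /=; rewrite in_itv/= => /andP[? ?];
    apply/orP; [right|left]; lra.
have /andP[z1 z2] : - 1 <= z <= 1.
  by move: (D12 _ Dz); rewrite /= in_itv/= => /andP[? ?]; apply/andP; split; lra.
have Np : 0 <= N%:R :> R by [].
apply: ler_pM => //.
- apply: (le_trans (sqr_ge0 0)); rewrite expr0n/=.
  rewrite -mean_square_jump_equispaced//; apply: Rintegral_ge0 => y _; exact: sqr_ge0.
- rewrite ler_pM2l ?exprn_gt0// lef_pV2 ?posrE ?exprn_gt0//; last first.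
    by apply: lt_le_trans zr.
  by rewrite lerXn2r ?nnegrE// ltW.
rewrite /balanced_mean_square; set t := N%:R * z; set m : R := (Num.floor t)%:~R.
have /andP[t1 t2] : - N%:R <= t <= N%:R by rewrite /t; apply/andP; split; nra.
have /andP[m1 m2] : - N%:R <= m <= N%:R.
  rewrite /m (pmulrn _ N) -rmorphN/= !ler_int; apply/andP; split.
    by rewrite floor_ge_int rmorphN/= -pmulrn.
  by rewrite -(ler_int R) -pmulrn (le_trans (floor_le _)).
apply: lerD; last by have := sqr_ge0 m; have := sqr_ge0 (N%:R : R); lra.
apply: (le_trans (ler_norm _)); rewrite normrM; apply: ler_pM => //.
  by rewrite ler_norml; apply/andP; split; lra.
by rewrite ler_norml t1 t2.
Qed.

(** For [z] in [[z1, 1/N)] the mean square exceeds its lower bound by at least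
    [2 (q - p)], and the weight is at least [4 c^2] as [z <= 1/2]: the integrand
    gains at least [k] on an interval of positive length.  Finiteness of the
    energy of the equispaced configuration turns this into a strict inequality. *)
Lemma core_energy_equispaced_lt s (a b : R) : size s = N ->
  a \in s -> b \in s -> 0 <= a -> a < b -> b < 1 ->
  circle_dist a b < N%:R^-1 -> (1 < N)%N ->
  (core_energy rho (H (equispaced N)) < core_energy rho (H s))%E.
Proof.
move=> sN sa sb a0 ab b1 dN N1; have r0 := rho0.
have Np : 0 < N%:R :> R by rewrite ltr0n.
have NV : N%:R^-1 <= 2^-1 :> R by rewrite lef_pV2 ?posrE// ler_nat.
pose u := Num.max rho (circle_dist a b).
have uN : u < N%:R^-1 by rewrite gt_max rhoN dN.
have [du ru] : circle_dist a b <= u /\ rho <= u by rewrite !le_max !lexx orbT.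
pose z1 := (u + N%:R^-1) / 2.
have [uz zN] : u < z1 /\ z1 < N%:R^-1 by rewrite /z1; split; lra.
have [p [q [p0 pq q1 hpq]]] : exists p q, [/\ 0 <= p, p < q, q <= 1 &
    forall z y, z1 <= z -> p <= y < q -> 2 <= jump s z y].
  by apply: (close_pair_overlap sa sb) => //; lra.
pose k : R := 8 * c ^+ 2 * (q - p).
have k0 : 0 < k by rewrite /k !mulr_gt0 ?exprn_gt0// subr_gt0.
pose J : set R := `[z1, N%:R^-1[%classic.
have mJ : measurable J by exact: measurable_itv.
have JD : J `<=` core_domain rho.
  move=> z; rewrite /J /= in_itv/= => /andP[? ?].
  by right; rewrite /= in_itv/=; apply/andP; split; lra.
have mD := measurable_core_domain rho.
have sq0 t z : (0%R <= (W z * mean_square_jump t z)%:E)%E.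
  by rewrite lee_fin mulr_ge0// Rintegral_ge0// => y _; exact: sqr_ge0.
have muJ : mu J = (N%:R^-1 - z1)%:E.
  by rewrite /J /= lebesgue_measure_itv/= lte_fin zN.
apply: (@lt_le_trans _ _ (core_energy rho (H (equispaced N)) + k%:E * mu J)%E).
  rewrite muJ lteDl ?lte_fin ?mulr_gt0 ?subr_gt0//.
  rewrite ge0_fin_numE; first exact: core_energy_equispaced_fin.
  by rewrite core_energyE; apply: integral_ge0 => z _; exact: sq0.
have -> : (k%:E * mu J = \int[mu]_(z in core_domain rho) (k%:E * (\1_J z)%:E))%E.
  rewrite ge0_integralZl_EFin//.
  - by rewrite integral_indic// setIidl.
  - by apply: measurable_funTS; apply/measurable_EFinP; exact: measurable_indic.
  - exact: ltW.
rewrite !core_energyE -ge0_integralD//; last 3 first.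
- by apply: measurable_funTS; exact: measurable_inner_energy.
- by move=> z _; rewrite -EFinM lee_fin mulr_ge0// ltW.
- apply: measurable_funTS; apply: measurable_funeM; apply/measurable_EFinP.
  exact: measurable_indic.
apply: ge0_le_integral => //.
- by move=> z _; rewrite adde_ge0// -EFinM lee_fin mulr_ge0// ltW.
- apply: measurable_funTS; apply: emeasurable_funD; first exact: measurable_inner_energy.
  by apply: measurable_funeM; apply/measurable_EFinP; exact: measurable_indic.
- by apply: measurable_funTS; exact: measurable_inner_energy.
move=> z Dz; rewrite -EFinM -EFinD lee_fin mean_square_jump_equispaced// indicE.
have [zJ|zJ] := boolP (z \in J); last first.
  by rewrite mulr0 addr0 ler_wpM2l// -sN mean_square_jump_ge.
set B := balanced_mean_square N z.
move: zJ; rewrite inE /J /= in_itv/= mulr1 => /andP[zz zN'].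
apply: (@le_trans _ _ (W z * (B + 2 * (q - p)))); last first.
  rewrite ler_wpM2l// /B -sN; apply: mean_square_jump_ge_overlap => //; first exact: ltW.
    rewrite sN; apply/andP; split; first by rewrite mulr_ge0//; lra.
    by rewrite mulrC -ltr_pdivlMr// mul1r.
  by move=> y; exact: hpq.
rewrite [X in _ <= X]mulrDr lerD2l /k /W.
have z0 : 0 < z by lra.
rewrite gtr0_norm//.
have -> : c ^+ 2 / z ^+ 2 * (2 * (q - p)) = 2 * c ^+ 2 / z ^+ 2 * (q - p) by ring.
rewrite ler_pM2r ?subr_gt0// ler_pdivlMr ?exprn_gt0//.
have : z ^+ 2 <= 2^-1 ^+ 2 by rewrite lerXn2r ?nnegrE//; lra.
have := sqr_ge0 c; nra.
Qed.

End Energy.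

(** * Minimizers *)
Section Main.
Context {R : realType}.

Lemma admissible_seq (N : nat) (rho : R) (X : set R) : admissible N rho X ->
  exists s : seq R, [/\ X = [set` s], uniq s, size s = N,
    sorted <=%R s & forall a, a \in s -> 0 <= a < 1].
Proof.
move=> [X01 XN _].
have fX : finite_set X by exists N.
pose s := sort <=%R (finmap.enum_fset (fset_set X)).
have sX : X = [set` s].
  by apply/seteqP; split => x /=; rewrite mem_sort in_fset_set// inE.
exists s; split => //.
- by rewrite sort_uniq finmap.fset_uniq.
- by rewrite size_sort; exact: card_fset_set.
- by apply: sort_sorted; exact: le_total.
- move=> a sa; have : X a by rewrite sX.
  by move=> /X01; rewrite /= in_itv.
Qed.

Lemma dislocation_energyE (lambda rho : R) (N : nat) (s : seq R) :
  0 < lambda -> (0 < N)%N -> uniq s -> (forall a, a \in s -> 0 <= a < 1) ->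
  dislocation_energy lambda N rho [set` s] =
  core_energy rho (fun x => - (lambda / N%:R) * staircase s x).
Proof.
move=> l0 N0 us s01; rewrite /dislocation_energy.
have [[mh _ _] [k hk]] := displacement_ae us s01 l0 N0.
apply: (ae_core_energy _ mh _ hk).
exact: measurable_H.
Qed.

Lemma admissible_equispaced (N : nat) (rho : R) : (0 < N)%N ->
  rho < N%:R^-1 -> admissible N rho [set` equispaced N : seq R].
Proof.
move=> N0 rN; split.
- by move=> a /= /(equispaced01 N0); rewrite in_itv.
- set s : seq R := equispaced N.
  have fs : finite_set [set` s] by exact: finite_seq.
  rewrite -(fset_setK fs); apply/card_eq_fsetP.
  rewrite -[RHS](size_equispaced (R := R) N); apply/perm_size/uniq_perm.
  + exact: finmap.fset_uniq.
  + exact: uniq_equispaced.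
  + by move=> x; rewrite in_fset_set// mem_setE.
- move=> a b /= sa sb ab; apply: (le_trans (ltW rN)).
  exact: circle_dist_equispaced.
Qed.

Lemma sorted_gaps (s : seq R) (N i j : nat) :
  (forall k, (k.+1 < N)%N -> N%:R^-1 <= s`_k.+1 - s`_k) ->
  (i <= j)%N -> (j < N)%N -> (j - i)%:R / N%:R <= s`_j - s`_i.
Proof.
move=> h; elim: j => [|j IH] ij jN.
  by move: ij; rewrite leqn0 => /eqP ->; rewrite subrr mul0r.
move: ij; rewrite leq_eqVlt => /predU1P[->|ij]; first by rewrite subnn subrr mul0r.
have h1 := h j jN; have h2 := IH ij (ltnW jN).
by rewrite subSn// -natr1 mulrDl mul1r; lra.
Qed.

Lemma sorted_uniq_lt (s : seq R) (i j : nat) : uniq s -> sorted <=%R s ->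
  (i < j)%N -> (j < size s)%N -> s`_i < s`_j.
Proof.
move=> us ss ij jN; have iN := ltn_trans ij jN.
rewrite lt_neqAle nth_uniq// (ltn_eqF ij)/=.
by apply: (sorted_leq_nth le_trans le_refl) => //; exact: ltnW.
Qed.

(** The [N] gaps around the circle add up to 1 and each is at least [1/N].  The gap
    through [0] is seen as the complementary arc in the distance of the first and
    the last point. *)
Lemma equal_gaps (s : seq R) (N : nat) : size s = N -> uniq s ->
  sorted <=%R s ->
  (forall i j, (i < j)%N -> (j < N)%N -> N%:R^-1 <= circle_dist s`_i s`_j) ->
  forall i, (i.+1 < N)%N -> circle_dist s`_i s`_i.+1 = N%:R^-1.
Proof.
move=> sN us ss gap i jN.
have distE k l : (k < l)%N -> (l < N)%N ->
    circle_dist s`_k s`_l = Num.min (s`_l - s`_k) (1 - (s`_l - s`_k)).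
  move=> kl lN; rewrite /circle_dist distrC gtr0_norm// subr_gt0.
  by apply: sorted_uniq_lt => //; rewrite sN.
have gap1 k l : (k < l)%N -> (l < N)%N -> N%:R^-1 <= s`_l - s`_k.
  by move=> kl lN; have := gap _ _ kl lN; rewrite distE// le_min => /andP[].
have gap2 k l : (k < l)%N -> (l < N)%N -> s`_l - s`_k <= 1 - N%:R^-1.
  move=> kl lN; have := gap _ _ kl lN; rewrite distE// le_min => /andP[_].
  by rewrite lerBrDr addrC -lerBrDr.
have N2 : (1 < N)%N by rewrite (leq_ltn_trans _ jN).
have N0 : (0 < N)%N by exact: ltnW.
have Np : 0 < N%:R :> R by rewrite ltr0n.
have gapS k : (k.+1 < N)%N -> N%:R^-1 <= s`_k.+1 - s`_k by exact: gap1.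
have N1lt : (N.-1 < N)%N by rewrite prednK.
have jN1 : (i.+1 <= N.-1)%N by rewrite -ltnS prednK.
have g1 := sorted_gaps gapS (leq0n i) (ltnW jN).
have g2 := sorted_gaps gapS jN1 N1lt.
have g3 : s`_N.-1 - s`_0 <= 1 - N%:R^-1 by apply: gap2 => //; rewrite -ltnS prednK.
have g4 := gap1 _ _ (ltnSn i) jN.
(* The gaps before [i], the gaps after [i + 1] and the gap through [0] already fill the
   circle up to [1 / N], which bounds the gap after [i] from above. *)
have tot : (i - 0)%:R / N%:R + (N.-1 - i.+1)%:R / N%:R + N%:R^-1 = 1 - N%:R^-1 :> R.
  rewrite subn0 natrB// -[in LHS]natr1.
  have -> : N.-1%:R = N%:R - 1 :> R by rewrite -subn1 natrB.
  by field; rewrite gt_eqF.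
have dE : s`_i.+1 - s`_i = N%:R^-1.
  by clear -g1 g2 g3 g4 tot; apply/eqP; rewrite eq_le; apply/andP; split; lra.
rewrite distE// dE; apply/min_idPl.
have NV : N%:R^-1 <= 2^-1 :> R by rewrite lef_pV2 ?posrE// ler_nat.
by clear -NV; lra.
Qed.

End Main.

Theorem theorem4p2 (R : realType) (lambda : R) (hlambda : 0 < lambda)
    (N : nat) (hN : (1 <= N)%N) (rho : R) (hrho0 : 0 < rho)
    (hrhoN : rho < N%:R^-1) :
  (exists X : set R, is_minimizer lambda N rho X) /\
  (forall X : set R, is_minimizer lambda N rho X ->
    exists x : 'I_N -> R,
      [/\ X = range x,
          forall i j : 'I_N, (i < j)%N -> x i < x j &
          forall i j : 'I_N, j = i.+1 :> nat ->
            circle_dist (x i) (x j) = N%:R^-1]).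
Proof.
have c0 : 0 < lambda / N%:R by rewrite divr_gt0// ltr0n.
have adE := admissible_equispaced hN hrhoN.
have Ee := dislocation_energyE rho hlambda hN (uniq_equispaced hN) (equispaced01 hN).
split.
  exists [set` equispaced N]; split; first exact: adE.
  move=> X' /admissible_seq[s [-> us sN _ s01]].
  rewrite Ee (dislocation_energyE rho hlambda hN us s01).
  exact: (core_energy_equispaced_le rho _ hN sN).
move=> X [/[dup] adX /admissible_seq[s [XE us sN ss s01]] minX].
have smem i : (i < N)%N -> s`_i \in s by move=> iN; rewrite mem_nth// sN.
have slt i j : (i < j)%N -> (j < N)%N -> s`_i < s`_j.
  by rewrite -sN; exact: sorted_uniq_lt.
have gap i j : (i < j)%N -> (j < N)%N -> N%:R^-1 <= circle_dist s`_i s`_j.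
  move=> ij jN; rewrite leNgt; apply/negP => dlt.
  have iN := ltn_trans ij jN.
  have N2 : (1 < N)%N := leq_ltn_trans (leq_ltn_trans (leq0n i) ij) jN.
  have /andP[a0 _] := s01 _ (smem _ iN).
  have /andP[_ b1] := s01 _ (smem _ jN).
  have := minX _ adE.
  rewrite Ee XE (dislocation_energyE rho hlambda hN us s01) leNgt => /negP; apply.
  exact: (core_energy_equispaced_lt hN hrho0 hrhoN c0 sN (smem _ iN) (smem _ jN)
    a0 (slt _ _ ij jN) b1 dlt N2).
clear minX adX adE Ee.
exists (fun i : 'I_N => s`_i); split.
- rewrite XE; apply/seteqP; split => x /=.
    move=> xs; have xN : (index x s < N)%N by rewrite -sN index_mem.
    by exists (Ordinal xN) => //=; rewrite nth_index.
  by move=> [i _ <-]; exact: smem.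
- by move=> i j ij; exact: slt.
move=> i j ji; have := ltn_ord j; rewrite ji => jN.
exact: (equal_gaps sN us ss gap jN).
Qed.
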